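(* Let $X$ be a Banach space with scalar field $\mathbb F$ and let $J$ be an interval of the form $[\alpha,\infty)$, $(\alpha,\infty)$ ($\alpha\in\mathbb R$) or $\mathbb R$. Assume that one of the following holds. (1) $\gamma\in BC(\mathbb R,\mathbb F)$, $\inf_{\mathbb R}|\gamma|>0$, $\gamma\,BUC(\mathbb R,X)$ is invariant, $\gamma\,BUC(\mathbb R,X)\subset M(\gamma\,BUC(\mathbb R,X))$, and $\limsup_{|t|\to\infty}\|u(t)\|\le\|u+\gamma v\|_\infty$ for all $u,v\in BUC(\mathbb R,X)$. (2) $\mathbb F=\mathbb C$ and $\gamma$ is only given on $J$, with $\gamma\in BC(J,\mathbb C)$, $\inf_J|\gamma|>0$, $\gamma\in MC_0(J,\mathbb C)$, and there exists $\varepsilon_0>0$ such that $\gamma_a/\gamma\in BUC(J,\mathbb C)$ for all $0<a<\varepsilon_0$. Then $BUC(J,X)+\gamma\,BUC(J,X)$ (with $\gamma$ replaced by its restriction $\gamma|_J$ in case (1)) satisfies $(P_b)$ and $(L_b)$.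
   Context: $X\neq\{0\}$, $\mathbb F\in\{\mathbb R,\mathbb C\}$. $BC$, $BUC$: bounded continuous, bounded uniformly continuous functions. $C_0(J,\mathbb C)$: uniformly continuous functions vanishing at infinity (as $t\to\infty$, and also as $t\to-\infty$ if $J=\mathbb R$). $\|f\|_\infty=\sup_t\|f(t)\|$; on $\mathbb R$, $\limsup_{|t|\to\infty}$ is the maximum of the limsups as $t\to\pm\infty$. $L^1_{\rm loc}(J,Y)$: all functions $J\to Y$ (not equivalence classes) Bochner–Lebesgue integrable over every compact interval contained in $J$; $L^\infty(J,X)$: all Bochner–Lebesgue measurable functions $J\to X$ that are bounded everywhere on $J$. $f_a(t)=f(t+a)$, $(\Delta_hf)(t)=f(t+h)-f(t)$, $(M_hf)(t)=\frac1h\int_0^hf(t+s)\,ds$ for $h>0$; $MA=\{f\in L^1_{\rm loc}:M_hf\in A\text{ for all }h>0\}$. $A\subset X^{\mathbb R}$ is invariant if $f_a\in A$ for all $f\in A$, $a\in\mathbb R$. $\gamma V=\{\gamma v:v\in V\}$, $U+V=\{u+v\}$. $(Pf)(t)=\int_{\alpha_0}^tf(s)\,ds$ with a fixed $\alpha_0\in J$ ($\alpha_0=0$ if $0\in J$). For $A\subset L^1_{\rm loc}(J,X)$: $A$ satisfies $(L_b)$ if $f\in L^\infty(J,X)$ and $\Delta_hf\in A$ for all $h>0$ imply $f\in A$; $A$ satisfies $(P_b)$ if $f\in A$ and $Pf$ bounded imply $Pf\in A$. *)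

(* Defs.v *)
From HB Require Import structures.
From mathcomp Require Import all_boot all_order all_algebra.
From mathcomp Require Import complex.
From mathcomp Require Import all_classical all_reals all_analysis.

Set Implicit Arguments.
Unset Strict Implicit.
Unset Printing Implicit Defensive.

Import Order.TTheory GRing.Theory Num.Theory.
Import numFieldNormedType.Exports.

Local Open Scope classical_set_scope.
Local Open Scope ring_scope.

Inductive scalars := RealScalars | ComplexScalars.

Definition scalar_field (R : realType) (F : scalars) : numFieldType :=
  match F with RealScalars => R | ComplexScalars => R[i] end.

Definition of_real (R : realType) (F : scalars) : R -> scalar_field R F :=
  match F return R -> scalar_field R F with
  | RealScalars => fun x => x
  | ComplexScalars => fun x => x%:C%C
  end.

Definition real_part (R : realType) (F : scalars) : scalar_field R F -> R :=
  match F return scalar_field R F -> R with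
  | RealScalars => fun x => x
  | ComplexScalars => fun z => complex.Re z
  end.

(* Functions on an interval J are total functions on R of which only the values
   on J matter; products and sums of classes are therefore closed under equality
   on J. *)
Section VectorValued.
Variables (R : realType) (F : scalars) (V : normedModType (scalar_field R F)).
Implicit Types (J : set R) (f u v : R -> V) (g : R -> scalar_field R F).
Implicit Types (A B : set (R -> V)).

Local Notation mu := (@lebesgue_measure R).

(* The norm of a normed module over K takes its values in K (here R or R[i]);
   they are nonnegative, hence real. *)
Definition rnorm (x : V) : R := real_part `|x|.

Definition simple (s : R -> V) : Prop :=
  finite_set (range s) /\
  forall x : V, measurable (s @^-1` [set x] : set (measurableTypeR R)).

Definition simple_integral (a b : R) (s : R -> V) : V :=
  \sum_(x \in range s) of_real F (fine (mu (`[a, b] `&` s @^-1` [set x]))) *: x.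

(* Bochner-Lebesgue measurability: since only almost everywhere convergence is
   required, Borel simple functions yield the Lebesgue measurable functions. *)
Definition bochner_measurable J f : Prop :=
  exists s : nat -> R -> V,
    (forall n, simple (s n)) /\
    {ae mu, forall t : R, J t -> s n t @[n --> \oo] --> f t}.

(* s is a sequence of simple functions converging to f almost everywhere on
   [a, b] and Cauchy in the L^1 norm (written with Borel functions only). *)
Definition bochner_approx (a b : R) f (s : nat -> R -> V) : Prop :=
  [/\ forall n, simple (s n),
      {ae mu, forall t : R, `[a, b]%classic t -> s n t @[n --> \oo] --> f t} &
      forall e : R, 0 < e -> exists N : nat, forall n m : nat,
        (N <= n)%N -> (N <= m)%N ->
        (\int[mu]_(t in `[a, b]%classic) (rnorm (s n t - s m t))%:E <= e%:E)%E].

Definition bochner_integrable (a b : R) f : Prop :=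
  exists s, bochner_approx a b f s.

Definition is_bochner_integral (a b : R) f (x : V) : Prop :=
  exists s, bochner_approx a b f s /\
    simple_integral a b (s n) @[n --> \oo] --> x.

(* Meaningful for a <= b; the junk value is 0. *)
Definition bochner_integral (a b : R) f : V :=
  xget 0 [set x | is_bochner_integral a b f x].

Definition oriented_integral (a b : R) f : V :=
  if a <= b then bochner_integral a b f else - bochner_integral b a f.

Definition L1loc J : set (R -> V) :=
  [set f | forall a b : R, a <= b -> `[a, b]%classic `<=` J -> bochner_integrable a b f].

Definition bounded_on J f : Prop :=
  exists M : R, forall t, J t -> rnorm (f t) <= M.

Definition unif_continuous_on J f : Prop :=
  forall e : R, 0 < e -> exists2 d : R, 0 < d &
    forall s t, J s -> J t -> `|s - t| < d -> rnorm (f s - f t) < e.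

Definition Linfty J : set (R -> V) :=
  [set f | bochner_measurable J f /\ bounded_on J f].

Definition BC J : set (R -> V) :=
  [set f | {within J, continuous f} /\ bounded_on J f].

Definition BUC J : set (R -> V) :=
  [set f | unif_continuous_on J f /\ bounded_on J f].

Definition C0 J : set (R -> V) :=
  [set f | [/\ unif_continuous_on J f,
               f t @[t --> +oo] --> (0 : V) &
               J = setT -> f t @[t --> -oo] --> (0 : V)]].

Definition translate (a : R) f : R -> V := fun t => f (t + a).

Definition difference (h : R) f : R -> V := fun t => f (t + h) - f t.

Definition mean (h : R) f : R -> V :=
  fun t => of_real F h^-1 *: oriented_integral 0 h (fun s => f (t + s)).

Definition primitive (alpha0 : R) f : R -> V :=
  fun t => oriented_integral alpha0 t f.

Definition mean_class J A : set (R -> V) :=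
  [set f | L1loc J f /\ forall h : R, 0 < h -> A (mean h f)].

Definition translation_invariant A : Prop :=
  forall f, A f -> forall a : R, A (translate a f).

Definition mul_class J g A : set (R -> V) :=
  [set f | exists2 v, A v & forall t, J t -> f t = g t *: v t].

Definition add_class J A B : set (R -> V) :=
  [set f | exists u v, [/\ A u, B v & forall t, J t -> f t = u t + v t]].

Definition satisfies_Lb J A : Prop :=
  forall f, Linfty J f -> (forall h : R, 0 < h -> A (difference h f)) -> A f.

Definition satisfies_Pb J (alpha0 : R) A : Prop :=
  forall f, A f -> bounded_on J (primitive alpha0 f) -> A (primitive alpha0 f).

Definition sup_norm f : \bar R := ereal_sup (range (fun t => (rnorm (f t))%:E)).

Definition limsup_norm f : \bar R :=
  Order.max (limf_esup (fun t : R => (rnorm (f t))%:E) +oo%R)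
            (limf_esup (fun t : R => (rnorm (f t))%:E) -oo%R).

End VectorValued.

Definition admissible_interval (R : realType) (J : set R) : Prop :=
  [\/ exists alpha : R, J = `[alpha, +oo[%classic,
      exists alpha : R, J = `]alpha, +oo[%classic |
      J = setT].

(* Scalar-valued functions are functions into the normed module K^o. *)
Notation scalar_module R F := (GRing.regular (scalar_field R F)).

(* Main.v *)
Require Import Defs.
From mathcomp Require Import all_boot all_order all_algebra.
From mathcomp Require Import complex.
From mathcomp Require Import all_classical all_reals all_analysis.
From mathcomp Require Import measurable_realfun.
From mathcomp Require Import ring lra.

Set Implicit Arguments.
Unset Strict Implicit.
Unset Printing Implicit Defensive.

Import Order.TTheory GRing.Theory Num.Theory.
Import numFieldNormedType.Exports.

Local Open Scope classical_set_scope.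
Local Open Scope ring_scope.

(** Why the theorem holds.  Let [A] be the class of the functions [u + gamma v]
on [J] with [u], [v] in [BUC].

Property (P_b): members of [A] are bounded and continuous, so their primitives
are Lipschitz, and a bounded primitive is itself in [BUC] ([sum_class_Pb]).

Property (L_b) rests on the following features of [gamma]: it is continuous
with [0 < c <= |gamma| <= Gm] on [J], its means [M_k gamma] vanish at infinity
for every [k > 0], and [gamma_a / gamma] is in [BUC(J)] for some [a > 0].  The
second case of the hypothesis says this outright.  In the first
case, invariance applied to [gamma x] for a vector [x != 0] gives the quotient
([translation_invariant_quotient]); and [M_k (gamma x) = gamma w] is in [BUC]
because means of bounded functions are Lipschitz, so the norm inequality for
[M_k (gamma x) - gamma w = 0] makes [M_k (gamma x)] vanish at infinity
([mean_vanishing]).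

The point is that averaging over short windows recovers the decomposition near
infinity.  If [f = u + gamma v], then [M_k f] is close to [u] for small [k]
and large [|t|], because [M_k (gamma v)(t)] is nearly [v(t) M_k gamma(t)]
([mean_product]); hence [(f - M_k f) / gamma] is close to [v].  Now let [f] be
bounded and measurable with all differences in [A].

- [f] is continuous: integrate [f(t) = f(t + h) - (f(t + h) - f(t))] over
  [h] between [0] and [1]; the first term becomes Lipschitz in [t], the second
  one continuous by dominated convergence ([cont_of_differences]).
- With [q = f - M_k f], each difference of [q], divided by [gamma], has at
  infinity a modulus of continuity [e] once [k] is small enough
  ([quotient_modulus]).  How small [k] must be, and how far out, depends on the
  step [h] of the difference; by Baire's theorem the same choice works for all
  [h] in some interval ([approx_by_BUC]).  Averaging over these [h]
  replaces [q(t + h)] by a function in [BUC], so some [G] in [BUC] makes the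
  modulus at infinity of [(f - G) / gamma] at most [e] ([average_approx]).
- If [G], [G'] belong to [e], [e'], then [W = G - G'] is in [BUC] and
  [W / gamma] has a small modulus at infinity, so [W], being close to
  [M_k W], is small at infinity ([small_at_infinity]).  Cutting off near the
  origin turns approximations for [e = 2^-n] into a uniformly convergent series
  ([glue]); its sum [u] is in [BUC], and [v = (f - u) / gamma] is uniformly
  continuous at infinity.
- On bounded parts of [J] only an open left end could spoil uniform continuity
  of [v].  A translation to the right moves away from that end, and both
  [gamma = gamma_a / (gamma_a / gamma)] and [f = f_a - (f_a - f)] are expressed
  through such translates ([gamma_local_BUC], [sum_class_from_differences]).

Of the Bochner integral these arguments use uniqueness of its value (by Fatou's
lemma), linearity, the norm bound, additivity over intervals and dominated
convergence; all are obtained by passing to the limit along bounded simple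
functions. *)

(** * Norms and convergence over the real and complex scalars *)

Lemma subrACA_sub (V : zmodType) (a b c d : V) : (a - b) - (c - d) = (a - c) - (b - d).
Proof. by rewrite !opprB addrACA [- b - c]addrC addrACA. Qed.

Section ScalarField.
Variables (R : realType) (F : scalars).
Local Notation K := (scalar_field R F).
Local Notation r2k := (@of_real R F).

Lemma of_real0 : r2k 0 = 0. Proof. by case: F. Qed.
Lemma of_real1 : r2k 1 = 1. Proof. by case: F. Qed.
Lemma of_realD x y : r2k (x + y) = r2k x + r2k y.
Proof. by case: F => //=; rewrite rmorphD. Qed.
Lemma of_realM x y : r2k (x * y) = r2k x * r2k y.
Proof. by case: F => //=; rewrite rmorphM. Qed.
Lemma of_realN x : r2k (- x) = - r2k x.
Proof. by case: F => //=; rewrite rmorphN. Qed.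
Lemma le_of_real x y : (r2k x <= r2k y) = (x <= y).
Proof. by case: F => //=; rewrite lecR. Qed.
Lemma lt_of_real x y : (r2k x < r2k y) = (x < y).
Proof. by case: F => //=; rewrite ltcR. Qed.
Lemma of_realK x : real_part (r2k x) = x.
Proof. by case: F. Qed.
Lemma of_real_inj : injective r2k.
Proof. exact: can_inj of_realK. Qed.
Lemma real_partK (z : K) : 0 <= z -> r2k (real_part z) = z.
Proof.
case: F z => //= z z0.
by case: z z0 => a b; rewrite lecE /= => /andP[/eqP -> _].
Qed.
Lemma norm_of_real x : `|r2k x| = r2k `|x|.
Proof. by case: F => //=; rewrite normc_def /= expr0n addr0 sqrtr_sqr. Qed.
End ScalarField.

Section Rnorm.
Variables (R : realType) (F : scalars) (V : normedModType (scalar_field R F)).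
Implicit Types (x y z : V).
Local Notation K := (scalar_field R F).

Lemma norm_rnorm x : `|x| = of_real F (rnorm x).
Proof. by rewrite /rnorm real_partK. Qed.
Lemma rnorm_ge0 x : 0 <= rnorm x.
Proof. by rewrite -(le_of_real F) -norm_rnorm of_real0. Qed.
Lemma rnorm0 : rnorm (0 : V) = 0.
Proof. by apply: (@of_real_inj R F); rewrite -norm_rnorm normr0 of_real0. Qed.
Lemma rnorm_eq0 x : (rnorm x == 0) = (x == 0).
Proof.
by rewrite -(inj_eq (@of_real_inj R F)) -norm_rnorm of_real0 normr_eq0.
Qed.
Lemma rnormN x : rnorm (- x) = rnorm x.
Proof. by rewrite /rnorm normrN. Qed.
Lemma rdistC x y : rnorm (x - y) = rnorm (y - x).
Proof. by rewrite -opprB rnormN. Qed.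
Lemma rnormD x y : rnorm (x + y) <= rnorm x + rnorm y.
Proof. by rewrite -(le_of_real F) of_realD -!norm_rnorm ler_normD. Qed.
Lemma rnormB x y : rnorm (x - y) <= rnorm x + rnorm y.
Proof. by rewrite -(rnormN y) rnormD. Qed.
Lemma rdist_tri y x z : rnorm (x - z) <= rnorm (x - y) + rnorm (y - z).
Proof. by apply: le_trans (rnormD _ _); rewrite addrA subrK. Qed.
Lemma rnorm_dist x y : `|rnorm x - rnorm y| <= rnorm (x - y).
Proof.
rewrite ler_norml lerBrDr lerBlDr addrC lerBlDr; apply/andP; split.
  by rewrite -{1}(subrK x y) rdistC addrC rnormD.
by rewrite -{1}(subrK y x) rnormD.
Qed.
Lemma rnorm_sum (I : Type) (s : seq I) (P : pred I) (f : I -> V) :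
  rnorm (\sum_(i <- s | P i) f i) <= \sum_(i <- s | P i) rnorm (f i).
Proof.
elim/big_rec2 : _ => [|i y x _ H]; first by rewrite rnorm0.
by apply: le_trans (rnormD _ _) _; rewrite lerD2l.
Qed.
End Rnorm.

Lemma rnormZ (R : realType) F (V : normedModType (scalar_field R F))
    (a : scalar_module R F) (x : V) :
  rnorm ((a : scalar_field R F) *: x) = rnorm a * rnorm x.
Proof.
apply: (@of_real_inj R F).
by rewrite of_realM -(norm_rnorm x) -(norm_rnorm a) -norm_rnorm normrZ.
Qed.


Lemma rnorm_of_real (R : realType) F (r : R) :
  rnorm (of_real F r : scalar_module R F) = `|r|.
Proof. by rewrite /rnorm norm_of_real of_realK. Qed.

Lemma rnormZr (R : realType) F (V : normedModType (scalar_field R F)) (r : R) (x : V) :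
  rnorm (of_real F r *: x) = `|r| * rnorm x.
Proof. by rewrite (rnormZ (of_real F r : scalar_module R F)) rnorm_of_real. Qed.

Lemma rnormV (R : realType) F (a : scalar_module R F) : 
  rnorm ((a : scalar_field R F)^-1 : scalar_module R F) = (rnorm a)^-1.
Proof.
have [->|a0] := eqVneq a 0; first by rewrite invr0 rnorm0 invr0.
have ra : rnorm a != 0 by rewrite rnorm_eq0.
apply: (mulIf ra); rewrite mulVf// -(rnormZ _ a).
rewrite /GRing.scale/= mulVf// /rnorm normr1.
by rewrite -(of_real1 R F) of_realK.
Qed.

Section RCvg.
Variables (R : realType) (F : scalars) (V : normedModType (scalar_field R F)).
Implicit Types (x y : V) (u : nat -> V).

Lemma cvg_rnormP u x : (u n @[n --> \oo] --> x) <->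
  forall e : R, 0 < e -> exists N : nat, forall n, (N <= n)%N -> rnorm (u n - x) < e.
Proof.
split=> [/cvgrPdist_lt H e e0|H].
  have := H (of_real F e); rewrite -{1}(of_real0 R F) lt_of_real => /(_ e0).
  move=> [N _ HN]; exists N => n Nn.
  by have := HN n Nn; rewrite /= norm_rnorm lt_of_real rdistC.
apply/cvgrPdist_lt => e e0.
have eE := real_partK (ltW e0).
have re0 : 0 < real_part e by rewrite -(lt_of_real F) of_real0 eE.
have [N HN] := H _ re0.
exists N => // n Nn /=; rewrite norm_rnorm -eE lt_of_real rdistC; exact: HN.
Qed.

Lemma cvg_rnorm_nearP (T : Type) (G : set_system T) (FG : Filter G) (f : T -> V) x :
  (f t @[t --> G] --> x) <->
  forall e : R, 0 < e -> \forall t \near G, rnorm (f t - x) < e.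
Proof.
split=> [/cvgrPdist_lt H e e0|H].
  have := H (of_real F e); rewrite -{1}(of_real0 R F) lt_of_real => /(_ e0).
  by apply: filterS => t /=; rewrite norm_rnorm lt_of_real rdistC.
apply/cvgrPdist_lt => e e0.
have eE := real_partK (ltW e0).
have re0 : 0 < real_part e by rewrite -(lt_of_real F) of_real0 eE.
have := H _ re0.
by apply: filterS => t /= ?; rewrite norm_rnorm -eE lt_of_real rdistC.
Qed.

Definition seq_cauchy u := forall e : R, 0 < e ->
  exists N : nat, forall n m, (N <= n)%N -> (N <= m)%N -> rnorm (u n - u m) < e.

Definition seq_complete := forall u, seq_cauchy u -> exists x, u n @[n --> \oo] --> x.

Lemma rcvg_unique u x y : u n @[n --> \oo] --> x -> u n @[n --> \oo] --> y -> x = y.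
Proof. by move=> ux uy; apply: (cvg_unique _ ux uy). Qed.

Lemma rcvg_rnorm_le u x (B : R) : u n @[n --> \oo] --> x ->
  (forall n, rnorm (u n) <= B) -> rnorm x <= B.
Proof.
move=> /cvg_rnormP ux uB; apply/ler_addgt0Pl => e e0.
have [N /(_ N (leqnn _)) HN] := ux _ e0.
rewrite -(subrK (u N) x); apply: le_trans (rnormD _ _) _.
by rewrite lerD// ltW// rdistC.
Qed.

Lemma rcvgZ (k : scalar_field R F) u x : u n @[n --> \oo] --> x ->
  k *: u n @[n --> \oo] --> k *: x.
Proof. exact: cvgZl_tmp. Qed.

End RCvg.

Lemma cvg_distP (R : realType) (u : nat -> R) (x : R) : (u n @[n --> \oo] --> x) <->
  forall e : R, 0 < e -> exists N : nat, forall n, (N <= n)%N -> `|u n - x| < e.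
Proof.
split=> [/cvgrPdist_lt H e e0|H].
  have [N _ HN] := H e e0; exists N => n Nn.
  by have := HN n Nn; rewrite /= distrC.
apply/cvgrPdist_lt => e e0.
have [N HN] := H _ e0.
exists N => // n Nn /=; rewrite distrC; exact: HN.
Qed.

Lemma complete_seq_complete (R : realType)
  F (X : completeNormedModType (scalar_field R F)) :
  seq_complete X.
Proof.
move=> u uC.
suff : cvg (u @ \oo) by move=> /cvg_ex[x ux]; exists x.
apply/cauchy_cvgP/cauchy_ballP => e e0.
have eE := real_partK (ltW e0).
have re0 : 0 < real_part e by rewrite -(lt_of_real F) of_real0 eE.
have [N HN] := uC _ re0.
rewrite near_map2; exists ([set n | (N <= n)%N], [set n | (N <= n)%N]) => /=.
  by split; exists N.
move=> [n m] [/= Nn Nm].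
by rewrite -ball_normE /= norm_rnorm -eE lt_of_real; apply: HN.
Qed.

Lemma real_seq_complete (R : realType) (u : nat -> R) :
  (forall e : R, 0 < e ->
  exists N : nat, forall n m, (N <= n)%N -> (N <= m)%N -> `|u n - u m| < e) ->
  exists x : R, u n @[n --> \oo] --> x.
Proof. exact: (@complete_seq_complete R RealScalars R). Qed.

(** The integral of [gamma] itself takes values in the scalar field, so
completeness of [R[i]] is needed as well as that of the Banach space. *)
Lemma scalar_seq_complete (R : realType) F : seq_complete (scalar_module R F).
Proof.
case: F => u uC; first exact: real_seq_complete uC.
have [a ua] : exists a : R, complex.Re (u n) @[n --> \oo] --> a.
  apply: real_seq_complete => e e0; have [N HN] := uC e e0.
  exists N => n m Nn Nm; apply: le_lt_trans (HN n m Nn Nm).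
  rewrite /rnorm/=.
  case: (u n) => a b; case: (u m) => c d /=.
  rewrite -(sqrtr_sqr (a - c)) ler_sqrt ?lerDl ?sqr_ge0//.
  by rewrite addr_ge0 ?sqr_ge0.
have [b ub] : exists a : R, complex.Im (u n) @[n --> \oo] --> a.
  apply: real_seq_complete => e e0; have [N HN] := uC e e0.
  exists N => n m Nn Nm; apply: le_lt_trans (HN n m Nn Nm).
  rewrite /rnorm/=.
  case: (u n) => a' b; case: (u m) => c d /=.
  rewrite -(sqrtr_sqr (b - d)) ler_sqrt ?lerDr ?sqr_ge0//.
  by rewrite addr_ge0 ?sqr_ge0.
exists (a +i* b)%C; apply/cvg_rnormP => e e0.
have e20 : 0 < e / 2 by lra.
have [N1 H1] := (cvg_distP _ _).1 ua _ e20.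
have [N2 H2] := (cvg_distP _ _).1 ub _ e20.
exists (maxn N1 N2) => n; rewrite geq_max => /andP[n1 n2].
have := H1 n n1; have := H2 n n2.
rewrite /rnorm/=; case: (u n) => c d /= {}H2 {}H1.

apply: (@le_lt_trans _ _ (`|c - a| + `|d - b|)); last by lra.
rewrite -[leRHS]ger0_norm ?addr_ge0// -(sqrtr_sqr (`|_| + `|_|)) ler_sqrt ?sqr_ge0//.
rewrite -(real_normK (num_real (c - a))) -(real_normK (num_real (d - b))).
have := mulr_ge0 (normr_ge0 (c - a)) (normr_ge0 (d - b)); lra.
Qed.


(** * Simple functions and their integrals *)

Section SimpleMaps.
Variables (R : realType).
Local Notation mu := (@lebesgue_measure R).

(** The same notion as [simple], but for maps into any choice type: two simple
functions then form one simple pair, over whose fibres both integrals can be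
computed. *)
Definition simple_map (T : choiceType) (p : R -> T) : Prop :=
  finite_set (range p) /\
  forall y : T, measurable (p @^-1` [set y] : set (measurableTypeR R)).

Lemma simple_map_preimage (T : choiceType) (p : R -> T) (A : set T) :
  simple_map p -> measurable (p @^-1` A : set (measurableTypeR R)).
Proof.
move=> [pf pm].
have -> : p @^-1` A = \bigcup_(y in range p `&` A) p @^-1` [set y].
  apply/seteqP; split=> [t At|t [y [_ Ay] /= ty]]; last by rewrite /preimage/= ty.
  by exists (p t) => //; split=> //; exists t.
apply: fin_bigcup_measurable => //.
exact: finite_setIl.
Qed.

Lemma simple_map_comp (T U : choiceType) (p : R -> T) (f : T -> U) :
  simple_map p -> simple_map (fun t => f (p t)).
Proof.
move=> sp; split.
  apply: (@sub_finite_set _ _ (f @` range p)); last first.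
    by apply: finite_image; case: sp.
  by move=> _ [t _ <-]; exists (p t) => //; exists t.
move=> y; exact: (simple_map_preimage (f @^-1` [set y]) sp).
Qed.

Lemma simple_map_pair (T U : choiceType) (p : R -> T) (q : R -> U) :
  simple_map p -> simple_map q -> simple_map (fun t => (p t, q t)).
Proof.
move=> [pf pm] [qf qm]; split.
  apply: (@sub_finite_set _ _ (range p `*` range q)); last exact: finite_setX.
  by move=> _ [t _ <-]; split; exists t.
move=> [y z].
rewrite (_ : _ @^-1` _ = p @^-1` [set y] `&` q @^-1` [set z]).
  exact: measurableI.
by apply/seteqP; split=> t /= [] => [<- <-|-> ->].
Qed.

Lemma simple_map_measurable d (U : measurableType d) (T : choiceType)
    (p : R -> T) (f : T -> U) (D : set R) : measurable (D : set (measurableTypeR R)) ->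
  simple_map p -> measurable_fun (D : set (measurableTypeR R)) (fun t => f (p t)).
Proof.
move=> mD sp _ A mA; apply: measurableI => //.
exact: (simple_map_preimage (f @^-1` A) sp).
Qed.

Lemma mu_itvI_fin (a b : R) (S : set R) : measurable (S : set (measurableTypeR R)) ->
  (mu (`[a, b] `&` S) \is a fin_num).
Proof.
move=> mS; rewrite ge0_fin_numE//.
apply: (@le_lt_trans _ _ (mu `[a, b]%classic)).
  apply: le_measure; [rewrite inE|rewrite inE//|exact: subIsetl].
  exact: measurableI.
by rewrite lebesgue_measure_itv/=; case: ifP => _; rewrite ?ltry// -EFinB ltry.
Qed.

Definition weight (a b : R) (S : set R) : R := fine (mu (`[a, b] `&` S)).

Lemma weight_ge0 a b S : 0 <= weight a b S.
Proof. exact: fine_ge0. Qed.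

Lemma weight_preimage (T : choiceType) (p : R -> T) (a b : R) (A : set T) :
  simple_map p ->
  weight a b (p @^-1` A) =
  \sum_(y \in range p) (if y \in A then weight a b (p @^-1` [set y]) else 0).
Proof.
move=> sp; rewrite /weight.
pose G y := if y \in A then `[a, b] `&` p @^-1` [set y] else set0.
have mG y : measurable (G y : set (measurableTypeR R)).
  by rewrite /G; case: ifP => // _; apply: measurableI => //; case: sp.
have -> : `[a, b] `&` p @^-1` A = \big[setU/set0]_(y \in range p) G y.
  rewrite fsbig_setU; last by case: sp.
  apply/seteqP; split=> [t [tab At]|t [y [t' _ <-]]].
    by exists (p t); [exists t|rewrite /G mem_set].
  by rewrite /G; case: ifP => // /set_mem Ay [? /= tE]; split=> //=; rewrite tE.
rewrite measure_fsbig//; [|by case: sp|].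
  have -> : \sum_(y \in range p) mu (G y) =
     (\sum_(y \in range p) (fine (mu (G y)))%:E)%E.
    apply: eq_fsbigr => y _; rewrite fineK// /G; case: ifP => _.
      by apply: mu_itvI_fin; case: sp.
    by rewrite measure0.
  rewrite fsumEFin; last by case: sp.
  by apply: eq_fsbigr => y _; rewrite /G; case: ifP => //; rewrite measure0.
apply/trivIsetP => y z _ _ yz; rewrite /G.
case: ifP => _; rewrite ?set0I//; case: ifP => _; rewrite ?setI0//.
apply/seteqP; split=> // t [[_ /= ty] [_ /= tz]].
by move: yz; rewrite -ty -tz eqxx.
Qed.

Lemma integral_simple (T : choiceType) (p : R -> T) (f : T -> R) (a b : R) :
  simple_map p -> (forall y, 0 <= f y) ->
  (\int[mu]_(t in `[a, b]) (f (p t))%:E =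
  (\sum_(y \in range p) weight a b (p @^-1` [set y]) * f y)%:E)%E.
Proof.
move=> sp f0; have [pf pm] := sp.
transitivity (\int[mu]_(t in `[a, b])
   (\sum_(y \in range p) ((f y)%:E * (\1_(p @^-1` [set y]) t)%:E)))%E.
  apply: eq_integral => t _.
  rewrite (fsbigD1 (p t))//=; [|by exists t].
  rewrite indicE mem_set//= mule1 fsbig1 ?adde0// => y [_ /= yt].
  by rewrite indicE memNset ?mule0//= => /esym.
rewrite ge0_integral_fsum//.
- rewrite -fsumEFin//; apply: eq_fsbigr => y _.
  have my := pm y.
  rewrite ge0_integralZl_EFin//; last first.
    by apply/measurable_EFinP; exact: measurable_indic.
  rewrite muleC EFinM; congr (_ * _)%E.
  rewrite (integral_indic _ _ my)// setIC.
  by apply/esym/fineK; exact: mu_itvI_fin.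
- move=> y; apply: measurable_funeM; apply/measurable_EFinP.
  exact: measurable_indic.
- by move=> y t _; rewrite mule_ge0// lee_fin.
Qed.

End SimpleMaps.


Section SimpleIntegral.
Variables (R : realType) (F : scalars) (V : normedModType (scalar_field R F)).
Local Notation mu := (@lebesgue_measure R).
Implicit Types (s : R -> V).

Lemma of_real_sum (I : Type) (r : seq I) (f : I -> R) :
  of_real F (\sum_(i <- r) f i) = \sum_(i <- r) of_real F (f i).
Proof. exact: (big_morph _ (@of_realD R F) (@of_real0 R F)). Qed.

(** Summing over the fibres of [p] instead of those of [f o p] merely splits
each level set into finitely many pieces. Linearity follows by taking a pair for
[p]. *)
Lemma simple_integral_comp (T : choiceType) (p : R -> T) (f : T -> V) a b :
  simple_map p ->
  simple_integral a b (fun t => f (p t)) =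
  \sum_(y \in range p) of_real F (weight a b (p @^-1` [set y])) *: f y.
Proof.
move=> sp; have sfp := simple_map_comp f sp.
rewrite /simple_integral (fsbig_finite _ _ sfp.1) (fsbig_finite _ _ sp.1) /=.
under eq_bigr => x _.
  rewrite -/(weight a b (p @^-1` (f @^-1` [set x]))).
  rewrite (weight_preimage a b (f @^-1` [set x]) sp) (fsbig_finite _ _ sp.1) /=.
  rewrite of_real_sum scaler_suml.
  over.
rewrite exchange_big /=; apply: eq_big_seq => y.
rewrite in_fset_set ?inE; last exact: sp.1.
move=> [t _ ty].
have fyin : f y \in finmap.enum_fset (fset_set (range (fun t => f (p t)))).
  by rewrite in_fset_set ?inE; [exists t => //; rewrite ty|exact: sfp.1].
rewrite (bigD1_seq (f y) fyin (finmap.fset_uniq _)) /= mem_set// big1 ?addr0// => x xf.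
by rewrite memNset ?of_real0 ?scale0r// => /= /esym /eqP; apply/negP.
Qed.

Lemma simple_integralD a b s1 s2 : simple s1 -> simple s2 ->
  simple_integral a b (fun t => s1 t + s2 t) =
  simple_integral a b s1 + simple_integral a b s2.
Proof.
move=> h1 h2; have h := simple_map_pair h1 h2.
rewrite (simple_integral_comp (fun z => z.1 + z.2) a b h).
have -> : simple_integral a b s1 = _ := simple_integral_comp fst a b h.
have -> : simple_integral a b s2 = _ := simple_integral_comp snd a b h.
rewrite !(fsbig_finite _ _ h.1) -big_split /=.
by apply: eq_bigr => z _; rewrite scalerDr.
Qed.

Lemma simple_integralZ a b (k : scalar_field R F) s : simple s ->
  simple_integral a b (fun t => k *: s t) = k *: simple_integral a b s.
Proof.
move=> h; rewrite (simple_integral_comp (fun x => k *: x) a b h).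
rewrite (_ : simple_integral a b s = simple_integral a b (fun t => id (s t)))//.
rewrite (simple_integral_comp id a b h) !(fsbig_finite _ _ h.1) scaler_sumr /=.
by apply: eq_bigr => z _; rewrite !scalerA mulrC.
Qed.

Lemma simple_integral_rnorm a b s : simple s ->
  ((rnorm (simple_integral a b s))%:E <=
   \int[mu]_(t in `[a, b]) (rnorm (s t))%:E)%E.
Proof.
move=> h; rewrite (integral_simple a b h (@rnorm_ge0 _ _ V)) lee_fin.
rewrite (_ : simple_integral a b s = simple_integral a b (fun t => id (s t)))//.
rewrite (simple_integral_comp id a b h) !(fsbig_finite _ _ h.1) /=.
apply: le_trans (rnorm_sum _ _ _) _; apply: ler_sum => x _.
by rewrite rnormZr ger0_norm ?weight_ge0.
Qed.

Lemma weight_split (a b c : R) (S : set R) : a <= b -> b <= c ->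
  measurable (S : set (measurableTypeR R)) ->
  weight a c S = weight a b S + weight b c S.
Proof.
move=> ab bc mS; rewrite /weight.
have ms : measurable ([set b] : set (measurableTypeR R)) by exact: measurable_set1.
have -> : `[a, c] `&` S = (`[a, b] `&` S) `|` (`]b, c] `&` S).
  rewrite -setIUl; congr (_ `&` _); apply/seteqP; split=> t /=; rewrite !in_itv/=.
    by move=> /andP[-> ->]; rewrite andbT; case: (leP t b) => _; [left|right].
  by move=> [|] /andP[t1 t2]; rewrite ?t1 ?t2 ?(le_trans t2)// ltW// (le_lt_trans ab).
rewrite measureU; [|exact: measurableI|exact: measurableI|]; last first.
  apply/seteqP; split=> // t /= []; rewrite !in_itv/= => -[/andP[_ tb] _] [/andP[bt _] _].
  by have := le_lt_trans tb bt; rewrite ltxx.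
have -> : mu (`[b, c] `&` S) = mu (`]b, c] `&` S).
  have -> : `[b, c]%classic = `]b, c]%classic `|` [set b].
    apply/seteqP; split=> t /=; rewrite !in_itv/=.
      by move=> /andP[]; rewrite le_eqVlt => /orP[/eqP ->|-> ->]; [right|left].
    by move=> [/andP[/ltW -> ->//]|->]; rewrite lexx.
  have mbS : measurable ([set b] `&` S : set (measurableTypeR R)).
    exact: measurableI.
  rewrite setIUl measureU0//; first exact: measurableI.
  apply/eqP; rewrite eq_le measure_ge0 andbT -(lebesgue_measure_set1 b).
  by apply: le_measure; rewrite ?inE//; exact: subIsetl.
rewrite fineD//; first exact: mu_itvI_fin.
have := mu_itvI_fin b c (measurableI _ _ (measurable_itv `]b, c]) mS).
rewrite setIA (_ : _ `&` `]b, c]%classic = `]b, c]%classic)//.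
by apply/setIidr => t /=; rewrite !in_itv/= => /andP[/ltW -> ->].
Qed.

Lemma simple_integral_split a b c s : a <= b -> b <= c -> simple s ->
  simple_integral a c s = simple_integral a b s + simple_integral b c s.
Proof.
move=> ab bc [sf sm]; rewrite /simple_integral !(fsbig_finite _ _ sf) -big_split /=.
apply: eq_bigr => x _; rewrite -scalerDl -of_realD.
by rewrite -/(weight a c _) (weight_split ab bc (sm x)).
Qed.

Lemma mu_translate (S : set R) (c : R) : measurable (S : set (measurableTypeR R)) ->
  mu ((fun t => t + c) @^-1` S) = mu S.
Proof.
move=> mS; apply/esym.
have mf : measurable_fun setT ((fun t => t + c) : measurableTypeR R -> measurableTypeR R).
  by apply: measurable_funD.
apply: (@lebesgue_measure_unique R (pushforward mu (fun t : measurableTypeR R => (t + c :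
  measurableTypeR R)))) => //.
move=> _ [[x y]] _ <- /=.
rewrite /pushforward.
rewrite (_ : _ @^-1` _ = `]x - c, y - c]%classic); last first.
  by apply/seteqP; split=> t /=; rewrite !in_itv/= ltrBlDr lerBrDr.
rewrite !lebesgue_measure_itv/= !lte_fin ltrD2r; case: ifP => // _.
by rewrite -!EFinB; congr EFin; ring.
Qed.

Lemma measurable_translate (S : set R) (c : R) : measurable (S : set (measurableTypeR R)) ->
  measurable ((fun t => t + c) @^-1` S : set (measurableTypeR R)).
Proof.
move=> mS.
have mf : measurable_fun setT ((fun t => t + c) : measurableTypeR R -> measurableTypeR R).
  by apply: measurable_funD.
by rewrite -[X in measurable X]setTI; apply: mf.
Qed.

Lemma simple_translate s c : simple s -> simple (translate c s).
Proof.
move=> [sf sm]; split.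
  by apply: sub_finite_set sf => _ [t _ <-]; exists (t + c).
by move=> x; exact: (measurable_translate c (sm x)).
Qed.

Lemma simple_integral_translate a b c s : simple s ->
  simple_integral a b (translate c s) = simple_integral (a + c) (b + c) s.
Proof.
move=> [sf sm]; rewrite /simple_integral.
have -> : range (translate c s) = range s.
  apply/seteqP; split=> _ [t _ <-]; first by exists (t + c).
  by exists (t - c) => //; rewrite /translate subrK.
apply: eq_fsbigr => x _; congr (of_real F (fine _) *: _).
rewrite -(mu_translate c (measurableI _ _ (measurable_itv `[a + c, b + c]) (sm x))).
congr (mu _); apply/seteqP.
by split=> t /= [+ tx]; rewrite !in_itv/= !lerD2r.
Qed.

End SimpleIntegral.


(** * Uniqueness of the Bochner integral *)

Section AlmostEverywhere.
Variable R : realType.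
Local Notation mu := (@lebesgue_measure R).

Lemma ae_sub (P Q : R -> Prop) : (forall t, P t -> Q t) ->
  {ae mu, forall t, P t} -> {ae mu, forall t, Q t}.
Proof.
by move=> PQ [N [mN N0 PN]]; exists N; split=> // t /= nQ; apply: PN => /= /PQ.
Qed.

Lemma ae_and (P Q : R -> Prop) : {ae mu, forall t, P t} -> {ae mu, forall t, Q t} ->
  {ae mu, forall t, P t /\ Q t}.
Proof.
move=> [N [mN N0 PN]] [M [mM M0 QM]]; exists (N `|` M); split.
- exact: measurableU.
- by rewrite measureU0.
- move=> t /= /not_andP[nP|nQ]; [left; exact: PN|right; exact: QM].
Qed.

Lemma ae_all (P : R -> Prop) : (forall t, P t) -> {ae mu, forall t, P t}.
Proof. by move=> HP; exists set0; split=> // t /=; have := HP t. Qed.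
End AlmostEverywhere.

Section BochnerIntegral.
Variables (R : realType) (F : scalars) (V : normedModType (scalar_field R F)).
Local Notation mu := (@lebesgue_measure R).
Implicit Types (s : nat -> R -> V) (f : R -> V).

Lemma simple_rnorm_measurable (a b : R) (w : R -> V) : simple w ->
  measurable_fun (`[a, b]%classic : set (measurableTypeR R)) (fun t => (rnorm (w t))%:E).
Proof.
move=> sw; exact: (simple_map_measurable (fun x => (rnorm x)%:E) (measurable_itv _) sw).
Qed.

Lemma simple_add (v w : R -> V) : simple v -> simple w -> simple (fun t => v t + w t).
Proof.
move=> sv sw; exact: (simple_map_comp (fun z => z.1 + z.2) (simple_map_pair sv sw)).
Qed.

Lemma simple_opp (w : R -> V) : simple w -> simple (fun t => - w t).
Proof. by move=> sw; exact: (simple_map_comp (fun z => - z) sw). Qed.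

Lemma simple_sub (v w : R -> V) : simple v -> simple w -> simple (fun t => v t - w t).
Proof. by move=> sv sw; apply: simple_add => //; apply: simple_opp. Qed.

Lemma simple_integralB a b (v w : R -> V) : simple v -> simple w ->
  simple_integral a b (fun t => v t - w t) =
  simple_integral a b v - simple_integral a b w.
Proof.
move=> sv sw; rewrite simple_integralD//; last exact: simple_opp.
rewrite -scaleN1r -simple_integralZ//; congr (_ + simple_integral _ _ _).
by apply/funext => t; rewrite scaleN1r.
Qed.

Lemma mu_itv (a b : R) : a <= b -> mu `[a, b]%classic = (b - a)%:E.
Proof.
move=> ab; rewrite lebesgue_measure_itv/= lte_fin.
case: ltP => // ba; have -> : b = a by apply/eqP; rewrite eq_le ab ba.
by rewrite subrr.
Qed.

Lemma mu_itv_lty (a b : R) : (mu `[a, b]%classic < +oo)%E.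
Proof. by rewrite lebesgue_measure_itv/=; case: ifP => _; rewrite ?ltry// -EFinB ltry. Qed.

Lemma integrable_cst_itv (a b M : R) :
  mu.-integrable (`[a, b]%classic : set (measurableTypeR R)) (cst M%:E).
Proof.
apply/integrableP; split; first exact: measurable_cst.
rewrite integral_cst// lte_mul_pinfty//; exact: mu_itv_lty.
Qed.

Lemma integral_rnorm_cvg0 a b M s : (forall n, simple (s n)) ->
  (forall n t, rnorm (s n t) <= M) ->
  {ae mu, forall t, `[a, b]%classic t -> s n t @[n --> \oo] --> (0 : V)} ->
  (\int[mu]_(t in `[a, b]) (rnorm (s n t))%:E)%E @[n --> \oo] --> (0 : \bar R).
Proof.
move=> ss sM s0.
have [//|//||||_ _] := @dominated_convergence _ _ _ mu `[a, b]%classic (measurable_itv _)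
  (fun n t => (rnorm (s n t))%:E) (cst 0%E) (cst M%:E).
- by move=> n; exact: simple_rnorm_measurable.
- apply: ae_sub s0 => t Ht /Ht /cvg_rnormP {}Ht.
  apply/fine_cvgP; split; first exact: nearW.
  apply/cvg_distP => e /Ht[N HN]; exists N => n /HN /=.
  by rewrite !subr0 (ger0_norm (rnorm_ge0 _)).
- exact: integrable_cst_itv.
- by apply: ae_all => t n _ /=; rewrite lee_fin (ger0_norm (rnorm_ge0 _)).
by rewrite integral0.
Qed.

Lemma ecvg0_lt (u : nat -> \bar R) (e : R) : u n @[n --> \oo] --> (0 : \bar R) -> 0 < e ->
  exists N : nat, forall n, (N <= n)%N -> (u n < e%:E)%E.
Proof.
move=> /fine_cvgP[[N1 _ H1] /cvg_distP H2] /H2 [N2 {}H2].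
exists (maxn N1 N2) => n; rewrite geq_max => /andP[/H1 h1 /H2].
rewrite subr0 /= => h2; rewrite -(fineK h1) lte_fin.
exact: le_lt_trans (ler_norm _) h2.
Qed.

(** Unlike [bochner_approx], this condition is inherited by sums, multiples,
restrictions and translates with no estimate to redo. *)
Definition bounded_approx (a b : R) f s : Prop :=
  [/\ forall n, simple (s n),
      exists M : R, forall n t, rnorm (s n t) <= M &
      {ae mu, forall t, `[a, b]%classic t -> s n t @[n --> \oo] --> f t}].

Lemma rcvg_subseq (u : nat -> V) (x : V) (k : nat -> nat) :
  (forall n, (n <= k n)%N) -> u n @[n --> \oo] --> x -> u (k n) @[n --> \oo] --> x.
Proof.
move=> kn /cvg_rnormP H; apply/cvg_rnormP => e /H [N HN]; exists N => n Nn.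
by apply: HN; apply: leq_trans Nn _.
Qed.

(** If the Cauchy condition failed for [e], some subsequence of differences
would have integrals above [e] although it tends to [0] boundedly. *)
Lemma bounded_approx_bochner a b f s : bounded_approx a b f s -> bochner_approx a b f s.
Proof.
move=> [ss [M sM] sf]; split=> // e e0; apply: contrapT => /forallNP H.
have {H} H N : exists p : nat * nat, [/\ (N <= p.1)%N, (N <= p.2)%N &
    (e%:E < \int[mu]_(t in `[a, b]%classic) (rnorm (s p.1 t - s p.2 t))%:E)%E].
  have /existsNP[n /existsNP[m]] := H N.
  by move=> /not_implyP[nN /not_implyP[mN /negP]]; rewrite -ltNge => ?; exists (n, m).
have [p Hp] := choice H.
have cv : (\int[mu]_(t in `[a, b]) (rnorm (s (p n).1 t - s (p n).2 t))%:E)%E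
     @[n --> \oo] --> (0 : \bar R).
  apply: (@integral_rnorm_cvg0 a b (M + M) (fun N t => s (p N).1 t - s (p N).2 t)).
  - by move=> n; apply: simple_sub.
  - by move=> n t; apply: le_trans (rnormB _ _) _; rewrite lerD.
  - apply: ae_sub sf => t Ht /Ht {}Ht; rewrite -(subrr (f t)).
    by apply: cvgB; apply: (rcvg_subseq _ Ht) => n; have [] := Hp n.
have [N /(_ N (leqnn _)) HN] := ecvg0_lt cv e0.
have [_ _] := Hp N; by move/(lt_trans HN); rewrite ltxx.
Qed.

Lemma simple_integral_cauchy a b f s : bochner_approx a b f s ->
  seq_cauchy (fun n => simple_integral a b (s n)).
Proof.
move=> [ss _ sc] e e0; have [N HN] := sc (e / 2) (divr_gt0 e0 (ltr0Sn _ _)).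
exists N => n m nN mN.
have : rnorm (simple_integral a b (s n) - simple_integral a b (s m)) <= e / 2; last lra.
rewrite -lee_fin; apply: le_trans (HN n m nN mN).
by rewrite -simple_integralB//; apply: simple_integral_rnorm; apply: simple_sub.
Qed.

Lemma integral_rnormD (a b : R) (v w : R -> V) : simple v -> simple w ->
  (\int[mu]_(t in `[a, b]) (rnorm (v t + w t))%:E <=
   \int[mu]_(t in `[a, b]) (rnorm (v t))%:E + \int[mu]_(t in `[a, b]) (rnorm (w t))%:E)%E.
Proof.
move=> sv sw; rewrite -ge0_integralD//; last 4 first.
- by move=> t _; rewrite lee_fin rnorm_ge0.
- exact: simple_rnorm_measurable.
- by move=> t _; rewrite lee_fin rnorm_ge0.
- exact: simple_rnorm_measurable.
apply: ge0_le_integral => //.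
- by move=> t _; rewrite lee_fin rnorm_ge0.
- by apply: simple_rnorm_measurable; apply: simple_add.
- by apply: emeasurable_funD; apply: simple_rnorm_measurable.
- by move=> t _; rewrite -EFinD lee_fin rnormD.
Qed.

(** The difference [w] of two approximations of the same function tends to [0]
almost everywhere and is Cauchy in mean; Fatou's lemma applied to [|w n - w m|]
as [m] grows bounds the integral of [|w n|]. *)
Lemma bochner_integral_unique a b f x y :
  is_bochner_integral a b f x -> is_bochner_integral a b f y -> x = y.
Proof.
move=> [s [[ss sf sc] sx]] [s' [[ss' sf' sc'] sy]].
pose w n t := s n t - s' n t.
have sw n : simple (w n) by apply: simple_sub.
have w0 : {ae mu, forall t, `[a, b]%classic t -> w n t @[n --> \oo] --> (0 : V)}.
  apply: ae_sub (ae_and sf sf') => t [H H'] tab; rewrite -(subrr (f t)).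
  by apply: cvgB; [apply: H|apply: H'].
have wc (e : R) : 0 < e -> exists N : nat, forall n m, (N <= n)%N -> (N <= m)%N ->
    (\int[mu]_(t in `[a, b]) (rnorm (w n t - w m t))%:E <= e%:E)%E.
  move=> e0; have e20 : 0 < e / 2 by lra.
  have [N1 H1] := sc _ e20; have [N2 H2] := sc' _ e20.
  exists (maxn N1 N2) => n m; rewrite !geq_max => /andP[n1 n2] /andP[m1 m2].
  have -> : e%:E = ((e / 2)%:E + (e / 2)%:E)%E by rewrite -EFinD; congr EFin; lra.
  apply: le_trans (leeD (H1 n m n1 m1) (H2 n m n2 m2)).
  have -> : (fun t => (rnorm (s' n t - s' m t))%:E) =
      (fun t => (rnorm (- (s' n t - s' m t)))%:E).
    by apply/funext => t; rewrite rnormN.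
  have -> : (fun t => (rnorm (w n t - w m t))%:E) =
      (fun t => (rnorm ((s n t - s m t) + - (s' n t - s' m t)))%:E).
    apply/funext => t; congr (rnorm _)%:E.
    exact: subrACA_sub.
  by apply: integral_rnormD; [|apply: simple_opp]; apply: simple_sub.
have wi (e : R) : 0 < e -> exists N : nat, forall n, (N <= n)%N ->
    (\int[mu]_(t in `[a, b]) (rnorm (w n t))%:E <= e%:E)%E.
  move=> e0; have [N HN] := wc e e0; exists N => n nN.
  pose g m t : \bar R := (rnorm (w n t - w m t))%:E.
  have mg m : measurable_fun (`[a, b]%classic : set (measurableTypeR R)) (g m).
    by apply: simple_rnorm_measurable; apply: simple_sub.
  have ml : measurable_fun (`[a, b]%classic : set (measurableTypeR R))
      (fun t => limn_einf (g ^~ t)).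
    rewrite (_ : (fun t => _) = (fun t => - limn_esup (fun m => - g m t)))%E//.
    apply: (measurableT_comp (@oppe_measurable R setT)).
    apply: measurable_fun_limn_esup => m.
    exact: (measurableT_comp (@oppe_measurable R setT) (mg m)).
  have -> : (\int[mu]_(t in `[a, b]) (rnorm (w n t))%:E =
      \int[mu]_(t in `[a, b]) limn_einf (g ^~ t))%E.
    apply: ae_eq_integral => //; first exact: simple_rnorm_measurable.
    apply: ae_sub w0 => t H tab; apply/esym.
    (* As [m] grows, [|w n - w m|] tends to [|w n|] almost everywhere. *)
    apply: (cvg_limn_einf_sup _).1; apply/fine_cvgP; split; first exact: nearW.
    apply/cvg_distP => d /((cvg_rnormP _ _).1 (H tab))[M HM].
    exists M => m /HM /=; rewrite subr0 => h; apply: le_lt_trans h.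
    by rewrite (le_trans (rnorm_dist _ _))// addrAC subrr add0r rnormN.
  apply: le_trans (fatou _ _ _ _) _ => //.
    by move=> m t _; rewrite lee_fin rnorm_ge0.
  apply: le_trans (limn_einf_sup _) _.
  apply: (@le_trans _ _ (ereal_sup ((fun m => (\int[mu]_(t in `[a, b]) g m t)%E) @`
     [set m | (N <= m)%N]))).
    by apply: ereal_inf_lbound; exists [set m | (N <= m)%N] => //; exists N.
  by apply: ge_ereal_sup => _ [m /= Nm <-]; exact: HN.
have : simple_integral a b (w n) @[n --> \oo] --> (0 : V).
  apply/cvg_rnormP => e e0; have [N HN] := wi (e / 2) (divr_gt0 e0 (ltr0Sn _ _)).
  exists N => n nN; rewrite subr0.
  have : rnorm (simple_integral a b (w n)) <= e / 2; last lra.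
  by rewrite -lee_fin; apply: le_trans (HN n nN); apply: simple_integral_rnorm.
move=> I0; apply/eqP; rewrite -subr_eq0; apply/eqP.
apply: (rcvg_unique _ I0).
have -> : (fun n => simple_integral a b (w n)) =
   (fun n => simple_integral a b (s n) - simple_integral a b (s' n)).
  by apply/funext => n; rewrite /w simple_integralB.
exact: cvgB.
Qed.


(** * Calculus of the Bochner integral *)

Definition bounded_measurable a b f := exists s, bounded_approx a b f s.

(** Cutting the simple functions at a level above the bound of [f] keeps their
limits: at a point of convergence only finitely many values are changed. *)
Lemma truncated_approx (D : set R) f s (B C : R) : B < C -> 0 <= C ->
  (forall n, simple (s n)) ->
  {ae mu, forall t, D t -> s n t @[n --> \oo] --> f t} ->
  (forall t, D t -> rnorm (f t) <= B) ->
  exists s' : nat -> R -> V,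
    [/\ forall n, simple (s' n), forall n t, rnorm (s' n t) <= C &
      {ae mu, forall t, D t -> s' n t @[n --> \oo] --> f t}].
Proof.
move=> BC C0 ss sf fB.
exists (fun n t => if rnorm (s n t) <= C then s n t else 0); split.
- by move=> n; exact: (simple_map_comp (fun x => if rnorm x <= C then x else 0) (ss n)).
- by move=> n t; case: ifP => // _; rewrite rnorm0.
- apply: ae_sub sf => t H Dt; have /cvg_rnormP st := H Dt.
  have [N HN] := st (C - B) ltac:(by rewrite subr_gt0).
  apply/cvg_rnormP => e /st[M HM]; exists (maxn N M) => n.
  rewrite geq_max => /andP[/HN nN /HM nM]; rewrite ifT//.
  rewrite -(subrK (f t) (s n t)) (le_trans (rnormD _ _))//.
  by have := fB t Dt; lra.
Qed.

Section Complete.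
Hypothesis hV : seq_complete V.

(** The choice made in the definition of the integral is immaterial: every
bounded approximation leads to the same value. *)
Lemma bochner_integralP a b f s : bounded_approx a b f s ->
  simple_integral a b (s n) @[n --> \oo] --> bochner_integral a b f.
Proof.
move=> bs; have sb := bounded_approx_bochner bs.
have [x sx] := hV (simple_integral_cauchy sb).
have ex : is_bochner_integral a b f x by exists s.
suff -> : bochner_integral a b f = x by [].
apply: (bochner_integral_unique _ ex).
rewrite /bochner_integral; by case: xgetP => // /(_ x) /(_ ex).
Qed.

Lemma bochner_integral_lim a b f s x : bounded_approx a b f s ->
  simple_integral a b (s n) @[n --> \oo] --> x -> bochner_integral a b f = x.
Proof. by move=> /bochner_integralP; exact: rcvg_unique. Qed.

Lemma bounded_approxD a b f g s s' : bounded_approx a b f s -> bounded_approx a b g s' ->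
  bounded_approx a b (fun t => f t + g t) (fun n t => s n t + s' n t).
Proof.
move=> [ss [M sM] sf] [ss' [M' sM'] sf']; split.
- by move=> n; apply: simple_add.
- by exists (M + M') => n t; rewrite (le_trans (rnormD _ _))// lerD.
- by apply: ae_sub (ae_and sf sf') => t [H H'] tab; apply: cvgD; [apply: H|apply: H'].
Qed.

Lemma bounded_measurableD a b f g : bounded_measurable a b f ->
  bounded_measurable a b g -> bounded_measurable a b (fun t => f t + g t).
Proof. by move=> [s hs] [s' hs']; exists (fun n t => s n t + s' n t); apply:
  bounded_approxD. Qed.

Lemma bochner_integralD a b f g : bounded_measurable a b f -> bounded_measurable a b g ->
  bochner_integral a b (fun t => f t + g t) =
    bochner_integral a b f + bochner_integral a b g.
Proof.
move=> [s hs] [s' hs']; apply: (bochner_integral_lim (bounded_approxD hs hs')).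
rewrite (_ : (fun n => _) = (fun n => simple_integral a b (s n)
  + simple_integral a b (s' n))).
  by apply: cvgD; apply: bochner_integralP.
by apply/funext => n; rewrite simple_integralD//; [case: hs|case: hs'].
Qed.

Lemma bounded_approxZ a b f s (k : scalar_field R F) : bounded_approx a b f s ->
  bounded_approx a b (fun t => k *: f t) (fun n t => k *: s n t).
Proof.
move=> [ss [M sM] sf]; split.
- by move=> n; exact: (simple_map_comp (fun z => k *: z) (ss n)).
- exists (@rnorm _ _ (scalar_module R F) k * M) => n t.
  by rewrite (rnormZ (k : scalar_module R F)) ler_wpM2l// rnorm_ge0.
- by apply: ae_sub sf => t H tab; apply: rcvgZ; apply: H.
Qed.

Lemma bounded_measurableZ a b f (k : scalar_field R F) : bounded_measurable a b f ->
  bounded_measurable a b (fun t => k *: f t).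
Proof. by move=> [s hs]; exists (fun n t => k *: s n t); apply: bounded_approxZ. Qed.

Lemma bochner_integralZ a b f (k : scalar_field R F) : bounded_measurable a b f ->
  bochner_integral a b (fun t => k *: f t) = k *: bochner_integral a b f.
Proof.
move=> [s hs]; apply: (bochner_integral_lim (bounded_approxZ k hs)).
rewrite (_ : (fun n => _) = (fun n => k *: simple_integral a b (s n))).
  by apply: rcvgZ; apply: bochner_integralP.
by apply/funext => n; rewrite simple_integralZ//; case: hs.
Qed.

Lemma bounded_measurableB a b f g : bounded_measurable a b f ->
  bounded_measurable a b g -> bounded_measurable a b (fun t => f t - g t).
Proof.
move=> hf /(bounded_measurableZ (-1)) hg; have := bounded_measurableD hf hg.
by under eq_fun do rewrite scaleN1r.
Qed.

Lemma bochner_integralB a b f g : bounded_measurable a b f -> bounded_measurable a b g ->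
  bochner_integral a b (fun t => f t - g t) =
    bochner_integral a b f - bochner_integral a b g.
Proof.
move=> hf hg; rewrite -[in RHS]scaleN1r -bochner_integralZ// -bochner_integralD//.
  by under [in RHS]eq_fun do rewrite scaleN1r.
exact: bounded_measurableZ.
Qed.

Lemma eq_bounded_measurable a b f g : (forall t, a <= t -> t <= b -> f t = g t) ->
  bounded_measurable a b f -> bounded_measurable a b g.
Proof.
move=> fg [s [ss sM sf]]; exists s; split => //.
apply: ae_sub sf => t H tab; rewrite -fg; first exact: H.
- by move: tab; rewrite /= in_itv/= => /andP[].
- by move: tab; rewrite /= in_itv/= => /andP[].
Qed.

Lemma eq_bochner_integral a b f g : (forall t, a <= t -> t <= b -> f t = g t) ->
  bochner_integral a b f = bochner_integral a b g.
Proof.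
move=> fg; rewrite /bochner_integral; congr (xget _ _); apply/seteqP.
have H (f1 f2 : R -> V) : (forall t, a <= t -> t <= b -> f1 t = f2 t) ->
    is_bochner_integral a b f1 `<=` is_bochner_integral a b f2.
  move=> f12 x [s [[ss sf sc] sx]]; exists s; split => //; split => //.
  apply: ae_sub sf => t H tab; rewrite -f12; first exact: H.
  - by move: tab; rewrite /= in_itv/= => /andP[].
  - by move: tab; rewrite /= in_itv/= => /andP[].
by split; apply: H => // t ? ?; rewrite fg.
Qed.

Lemma integral_rnorm_le a b M (w : R -> V) : a <= b -> simple w ->
  (forall t, rnorm (w t) <= M) ->
  (\int[mu]_(t in `[a, b]) (rnorm (w t))%:E <= (M * (b - a))%:E)%E.
Proof.
move=> ab sw wM; rewrite EFinM -mu_itv// -integral_cst//.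
apply: ge0_le_integral => //.
- by move=> t _; rewrite lee_fin rnorm_ge0.
- exact: simple_rnorm_measurable.
- by move=> t _; rewrite lee_fin.
Qed.

(** Truncation at a level slightly above [M] bounds the integrals of the
approximations themselves. *)
Lemma bochner_integral_le a b f M : a <= b -> bounded_measurable a b f ->
  (forall t, a <= t -> t <= b -> rnorm (f t) <= M) ->
  rnorm (bochner_integral a b f) <= M * (b - a).
Proof.
move=> ab [s [ss _ sf]] fM.
have M0 : 0 <= M by apply: le_trans (fM a _ _) => //; exact: rnorm_ge0.
apply/ler_addgt0Pr => e e0.
(* The summand 1 keeps the denominator positive when [a = b]. *)
pose d := e / (b - a + 1).
have ba0 : 0 < b - a + 1 by rewrite ltr_pwDr// subr_ge0.
have d0 : 0 < d by rewrite divr_gt0.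
have [] := @truncated_approx `[a, b]%classic f s M (M + d) _ _ ss sf.
- by lra.
- by lra.
- by move=> t /=; rewrite in_itv/= => /andP[ta tb]; apply: fM.
move=> s' [ss' sM' sf'].
have bs : bounded_approx a b f s' by split => //; exists (M + d).
apply: (rcvg_rnorm_le (bochner_integralP bs)) => n.
apply: (@le_trans _ _ ((M + d) * (b - a))).
  rewrite -lee_fin (le_trans (simple_integral_rnorm _ _ (ss' n)))//.
  exact: integral_rnorm_le.
rewrite mulrDl lerD2l /d -mulrAC ler_pdivrMr//.
by rewrite ler_wpM2l ?(ltW e0)// lerDl.
Qed.

Lemma bounded_approx_sub a b a' b' f s : a <= a' -> b' <= b ->
  bounded_approx a b f s -> bounded_approx a' b' f s.
Proof.
move=> aa bb [ss sM sf]; split => //.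
apply: ae_sub sf => t H tab; apply: H; move: tab; rewrite /= !in_itv/=.
by move=> /andP[/(le_trans aa) -> tb]; rewrite (le_trans tb bb).
Qed.

Lemma bochner_integral_split a b c f : a <= b -> b <= c -> bounded_measurable a c f ->
  bochner_integral a c f = bochner_integral a b f + bochner_integral b c f.
Proof.
move=> ab bc [s hs]; apply: (bochner_integral_lim hs).
rewrite (_ : (fun n => _) = (fun n => simple_integral a b (s n)
  + simple_integral b c (s n))).
  by apply: cvgD; apply: bochner_integralP; apply: bounded_approx_sub hs.
by apply/funext => n; apply: simple_integral_split => //; case: hs.
Qed.

Lemma bounded_approx_translate a b c f s : bounded_approx (a + c) (b + c) f s ->
  bounded_approx a b (translate c f) (fun n => translate c (s n)).
Proof.
move=> [ss [M sM] [N [mN N0 sN]]]; split.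
- by move=> n; apply: simple_translate.
- by exists M => n t; apply: sM.
- exists ((fun t => t + c) @^-1` N); split.
  + exact: measurable_translate.
  + by have := mu_translate c mN; rewrite N0.
  + move=> t /= H; apply: sN => /= H'; apply: H => tab; apply: H'.
    by rewrite /= in_itv/= !lerD2r; move: tab; rewrite in_itv/=.
Qed.

Lemma bounded_measurable_translate a b c f : bounded_measurable (a + c) (b + c) f ->
  bounded_measurable a b (translate c f).
Proof. by move=> [s hs]; exists (fun n => translate c (s n)); apply:
  bounded_approx_translate. Qed.

Lemma bochner_integral_translate a b c f : bounded_measurable (a + c) (b + c) f ->
  bochner_integral a b (translate c f) = bochner_integral (a + c) (b + c) f.
Proof.
move=> [s hs]; apply: (bochner_integral_lim (bounded_approx_translate hs)).
rewrite (_ : (fun n => _) = (fun n => simple_integral (a + c) (b + c) (s n))).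
  exact: bochner_integralP.
by apply/funext => n; rewrite simple_integral_translate//; case: hs.
Qed.

(** The functions [|f n|] need not be Borel. They are almost everywhere equal to
the Borel functions [d n], upper limits of the norms of simple functions, to
which scalar dominated convergence applies. *)
Lemma bochner_integral_cvg0 a b (f : nat -> R -> V) M :
  (forall n, bounded_measurable a b (f n)) ->
  (forall n t, a <= t -> t <= b -> rnorm (f n t) <= M) ->
  (forall t, a <= t -> t <= b -> f n t @[n --> \oo] --> (0 : V)) ->
  bochner_integral a b (f n) @[n --> \oo] --> (0 : V).
Proof.
move=> mf fM f0.
have inI t : `[a, b]%classic t -> a <= t /\ t <= b.
  by rewrite /= in_itv/= => /andP[].
pose C : R := `|M| + 1.
have H n : exists s : nat -> R -> V,
    [/\ forall n, simple (s n), forall n t, rnorm (s n t) <= C &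
      {ae mu, forall t, `[a, b]%classic t -> s n t @[n --> \oo] --> f n t}].
  have [s [ss _ sf]] := mf n.
  apply: (@truncated_approx `[a, b]%classic (f n) s M C) => //.
  - by have := ler_norm M; rewrite /C; lra.
  - by have := normr_ge0 M; rewrite /C; lra.
  - by move=> t /inI[ta tb]; apply: fM.
have [s Hs] := choice H.
pose g n k (t : R) : \bar R := (rnorm (s n k t))%:E.
pose d n (t : R) : \bar R := limn_esup (fun k => g n k t).
have mg n k : measurable_fun (`[a, b]%classic : set (measurableTypeR R)) (g n k).
  by apply: simple_rnorm_measurable; have [] := Hs n.
have md n : measurable_fun (`[a, b]%classic : set (measurableTypeR R)) (d n).
  exact: measurable_fun_limn_esup.
have gd : {ae mu, forall t, forall n, `[a, b]%classic t ->
    g n k t @[k --> \oo] --> d n t /\ d n t = (rnorm (f n t))%:E}.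
  apply: ae_foralln => n; have [_ _ sf] := Hs n.
  apply: ae_sub sf => t H' tab; have {}H' := H' tab.
  have gc : g n k t @[k --> \oo] --> (rnorm (f n t))%:E.
    apply/fine_cvgP; split; first exact: nearW.
    apply/cvg_distP => e /((cvg_rnormP _ _).1 H')[N HN]; exists N => k /HN.
    by apply: le_lt_trans; apply: rnorm_dist.
  by rewrite /d (cvg_limn_einf_sup gc).2.
have Id n : ((rnorm (bochner_integral a b (f n)))%:E <= \int[mu]_(t in `[a, b]) d n t)%E.
  have [ss sC sf] := Hs n.
  have bs : bounded_approx a b (f n) (s n) by split => //; exists C.
  have [//|//||||_ _ cv] := @dominated_convergence _ _ _ mu `[a,
    b]%classic (measurable_itv _)
    (g n) (d n) (cst C%:E).
  - by apply: ae_sub gd => t H' tab; have [] := H' n tab.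
  - exact: integrable_cst_itv.
  - by apply: ae_all => t k _ /=; rewrite lee_fin ger0_norm ?rnorm_ge0.
  have c1 : (rnorm (simple_integral a b (s n k)))%:E @[k --> \oo] -->
      (rnorm (bochner_integral a b (f n)))%:E.
    apply/fine_cvgP; split; first exact: nearW.
    apply/cvg_distP => e /((cvg_rnormP _ _).1 (bochner_integralP bs))[N HN];
      exists N => k /HN.
    by apply: le_lt_trans; apply: rnorm_dist.
  apply: (lee_cvg_to c1 cv); apply: nearW => k.
  exact: simple_integral_rnorm.
have [//|//||||_ _ cv] := @dominated_convergence _ _ _ mu `[a, b]%classic (measurable_itv _)
    d (cst 0%E) (cst C%:E).
- apply: ae_sub gd => t H' tab; have [ta tb] := inI _ tab.
  rewrite (_ : d ^~ t = fun n => (rnorm (f n t))%:E); last first.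
    by apply/funext => n; have [] := H' n tab.
  apply/fine_cvgP; split; first exact: nearW.
  apply/cvg_distP => e /((cvg_rnormP _ _).1 (f0 t ta tb))[N HN]; exists N => k /HN.
  by rewrite !subr0 /= ger0_norm ?rnorm_ge0.
- exact: integrable_cst_itv.
- apply: ae_sub gd => t H' n tab; have [ta tb] := inI _ tab.
  have [_ ->] := H' n tab; rewrite /= lee_fin ger0_norm ?rnorm_ge0//.
  by apply: le_trans (fM n t ta tb) _; have := ler_norm M; rewrite /C; lra.
rewrite integral0 in cv; apply/cvg_rnormP => e e0.
have [N HN] := ecvg0_lt cv e0; exists N => n /HN.
by rewrite subr0 -lte_fin; apply: le_lt_trans; apply: Id.
Qed.

End Complete.
End BochnerIntegral.

(** * Continuous functions and their means *)

Section Continuity.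
Variables (R : realType) (F : scalars) (V : normedModType (scalar_field R F)).
Implicit Types (J : set R) (f g : R -> V).

Definition cont_on J f := forall t, J t -> forall e : R, 0 < e ->
  exists2 d : R, 0 < d & forall s, J s -> `|s - t| < d -> rnorm (f s - f t) < e.

Lemma within_cont_on J f : {within J, continuous f} -> cont_on J f.
Proof.
move=> /subspace_continuousP H t Jt e e0.
have /cvg_rnorm_nearP/(_ e e0) := H t Jt; rewrite near_withinE.
move=> /nbhs_ballP[d /= d0 Hd]; exists d => // s Js st.
by apply: Hd => //; rewrite /ball/= distrC.
Qed.

Lemma cont_on_sub (J J' : set R) f : J' `<=` J -> cont_on J f -> cont_on J' f.
Proof.
move=> JJ H t Jt e e0; have [d d0 Hd] := H t (JJ _ Jt) e e0.
by exists d => // s Js; apply: Hd; apply: JJ.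
Qed.

Lemma unif_cont_on J f : unif_continuous_on J f -> cont_on J f.
Proof.
move=> H t Jt e e0; have [d d0 Hd] := H e e0.
by exists d => // s Js st; apply: Hd.
Qed.

(** Heine and Cantor: local moduli, made uniform by compactness of the segment.
*)
Lemma cont_unif_segment (a b : R) f :
  cont_on `[a, b]%classic f -> unif_continuous_on `[a, b]%classic f.
Proof.
move=> fc e e0.
have [] := (@compact_near_coveringP R `[a, b]%classic).1 (@segment_compact _ a b)
  nat \oo (fun n x => forall s, `[a, b]%classic s -> `[a, b]%classic x ->
   `|s - x| < n.+1%:R^-1 -> rnorm (f s - f x) < e) _ _; last first.
  move=> N _ HN; exists N.+1%:R^-1; first by rewrite invr_gt0.
  by move=> s t sK tK st; apply: (HN N (leqnn N)).
move=> x0 x0K; have [d d0 Hd] := fc x0 x0K (e / 2) ltac:(lra).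
have d20 : 0 < d / 2 by lra.
exists (ball x0 (d / 2), [set n : nat | n.+1%:R^-1 < d / 2]).
  split => /=; first exact: nbhsx_ballx.
  exists (Num.truncn (d / 2)^-1) => // n /= Nn.
  rewrite -(invrK (d / 2)) ltf_pV2 ?posrE ?invr_gt0//.
  by have := truncnS_gt (d / 2)^-1; move/lt_le_trans; apply; rewrite ler_nat.
move=> [x n] [/= xx0 nd] s sK xK sx; rewrite /ball/= distrC in xx0.
have {}sx := lt_trans sx nd; clear nd.
apply: le_lt_trans (rdist_tri (f x0) _ _) _.
have h1 : rnorm (f s - f x0) < e / 2.
  apply: Hd => //; rewrite -(subrK x s) -addrA.
  by apply: le_lt_trans (ler_normD _ _) _; lra.
have h2 : rnorm (f x - f x0) < e / 2 by apply: Hd => //; apply: lt_le_trans xx0 _; lra.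
by rewrite (rdistC (f x0)); lra.
Qed.

End Continuity.

Section ContinuousBmeas.
Variables (R : realType) (F : scalars) (V : normedModType (scalar_field R F)).

(** Rounds [min b t] down to the grid of mesh [1 / (n + 1)] based at [a];
arguments below [a] go to [a] because [truncn] of a negative number is [0]. *)
Definition grid_floor (a b : R) (n : nat) (t : R) : R :=
  a + (Num.truncn ((Num.min b t - a) * n.+1%:R))%:R / n.+1%:R.

Lemma grid_floor_itv a b n t : a <= b -> a <= grid_floor a b n t <= b.
Proof.
move=> ab; rewrite /grid_floor lerDl divr_ge0//=.
have [x0|x0] := leP 0 ((Num.min b t - a) * n.+1%:R).
  have /andP[h _] := truncn_itv x0.
  rewrite -lerBrDl ler_pdivrMr// (le_trans h)// ler_pM2r// lerB//.
  by rewrite ge_min lexx.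
by rewrite (truncn0Pn _ _) ?mul0r ?addr0// -ltNge (lt_trans x0).
Qed.

Lemma grid_floor_close a b n t : a <= t -> t <= b ->
  `|grid_floor a b n t - t| <= n.+1%:R^-1.
Proof.
move=> at' tb; rewrite /grid_floor (min_idPr tb).
have n0 : 0 < n.+1%:R :> R by [].
have x0 : 0 <= (t - a) * n.+1%:R by rewrite mulr_ge0// subr_ge0.
have /andP[h1 h2] := truncn_itv x0.
set k := Num.truncn _ in h1 h2 *.
have h1' : k%:R / n.+1%:R <= t - a by rewrite ler_pdivrMr.
have h2' : t - a <= k%:R / n.+1%:R + n.+1%:R^-1.
  have -> : k%:R / n.+1%:R + n.+1%:R^-1 = k.+1%:R / n.+1%:R :> R.
    by rewrite -[k.+1%:R]natr1 mulrDl mul1r.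
  by rewrite ler_pdivlMr// ltW.
move: h1' h2'; set q := k%:R / _; set i := _^-1 => h1' h2'.
rewrite ler_norml; apply/andP; split; lra.
Qed.

Lemma simple_map_grid a b n : a <= b -> simple_map (grid_floor a b n).
Proof.
move=> ab; split.
  pose N := Num.truncn ((b - a) * n.+1%:R).
  apply: (@sub_finite_set _ _ ((fun k : nat => a + k%:R / n.+1%:R) @` `I_N.+1)); last first.
    exact/finite_image/finite_II.
  move=> _ [t _ <-]; exists (Num.truncn ((Num.min b t - a) * n.+1%:R)) => //=.
  by rewrite ltnS /N le_truncn// ler_pM2r// lerB// ge_min lexx.
have mg : measurable_fun setT (grid_floor a b n : measurableTypeR R -> measurableTypeR R).
  apply: nondecreasing_measurable => // s t st.
  rewrite /grid_floor lerD2l ler_pM2r ?invr_gt0// ler_nat le_truncn//.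
  by rewrite ler_pM2r// lerB// le_min !ge_min lexx st orbT.
move=> y; rewrite -[X in measurable X]setTI; exact: mg.
Qed.

(** Sampling [f] at grid points gives simple functions that converge at every
point of the segment. *)
Lemma cont_bounded_measurable (a b B : R) (f : R -> V) : a <= b ->
  cont_on `[a, b]%classic f ->
  (forall t, a <= t -> t <= b -> rnorm (f t) <= B) -> bounded_measurable a b f.
Proof.
move=> ab fc fB; exists (fun n t => f (grid_floor a b n t)); split.
- by move=> n; exact: (simple_map_comp f (simple_map_grid n ab)).
- by exists B => n t; have /andP[? ?] := grid_floor_itv n t ab; apply: fB.
- apply: ae_all => t /[dup] tI; rewrite /= in_itv/= => /andP[at' tb].
  apply/cvg_rnormP => e e0; have [d d0 Hd] := fc t tI e e0.
  exists (Num.truncn d^-1) => n nN; apply: Hd.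
    by rewrite /= in_itv/=; exact: grid_floor_itv.
  apply: le_lt_trans (grid_floor_close n at' tb) _.
  rewrite -(invrK d) ltf_pV2 ?posrE ?invr_gt0//.
  by have := truncnS_gt d^-1; move/lt_le_trans; apply; rewrite ler_nat.
Qed.

End ContinuousBmeas.

Section Means.
Variables (R : realType) (F : scalars) (V : normedModType (scalar_field R F)).
Hypothesis hV : seq_complete V.
Variable J : set R.
Hypothesis upJ : forall s t, J s -> s <= t -> J t.
Implicit Types (f g : R -> V).

Definition bounded_measurable_on f := forall a b, J a -> a <= b -> bounded_measurable a b f.

Lemma cont_bounded_measurable_on f : cont_on J f -> bounded_on J f ->
  bounded_measurable_on f.
Proof.
move=> fc [B fB] a b Ja ab; apply: (@cont_bounded_measurable _ _ _ _ _ B) => //.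
  apply: cont_on_sub fc => t /=; rewrite in_itv/= => /andP[at' _]; exact: upJ at'.
by move=> t at' _; apply: fB; exact: upJ at'.
Qed.

(** A mean is an integral over a moving window of a fixed function, so
additivity over intervals applies to it. *)
Lemma meanE k f t : 0 < k -> bounded_measurable_on f -> J t ->
  mean k f t = of_real F k^-1 *: bochner_integral t (t + k) f.
Proof.
move=> k0 mf Jt; rewrite /mean /oriented_integral (ltW k0).
have E : (fun s => f (t + s)) = translate t f.
  by apply/funext => s; rewrite /translate addrC.
have h : bounded_measurable (0 + t) (k + t) f.
  by rewrite add0r [k + t]addrC; apply: mf => //; rewrite lerDl ltW.
by rewrite E (bochner_integral_translate hV h) add0r [k + t]addrC.
Qed.

Lemma bounded_measurable_tk f t k : bounded_measurable_on f -> 0 < k -> J t ->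
  bounded_measurable t (t + k) f.
Proof. by move=> mf k0 Jt; apply: mf => //; rewrite lerDl ltW. Qed.

Lemma bounded_measurable_onD f g : bounded_measurable_on f -> bounded_measurable_on g ->
  bounded_measurable_on (fun t => f t + g t).
Proof. by move=> mf mg a b Ja ab; apply: bounded_measurableD; [apply: mf|apply: mg]. Qed.

Lemma bounded_measurable_onB f g : bounded_measurable_on f -> bounded_measurable_on g ->
  bounded_measurable_on (fun t => f t - g t).
Proof. by move=> mf mg a b Ja ab; apply: bounded_measurableB; [apply: mf|apply: mg]. Qed.

Lemma eq_bounded_measurable_on f g : (forall t, J t -> f t = g t) ->
  bounded_measurable_on f -> bounded_measurable_on g.
Proof.
move=> fg mf a b Ja ab; apply: eq_bounded_measurable (mf a b Ja ab) => t at' _; apply: fg.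
exact: upJ at'.
Qed.

Lemma bounded_measurable_cst (a b : R) (x : V) :
  bounded_approx a b (fun=> x) (fun _ _ => x).
Proof.
split; last by apply: ae_all => t _; exact: cvg_cst.
- move=> _; split.
    by apply: (@sub_finite_set _ _ [set x]) => [_ [t _ <-]|]//; exact: finite_set1.
  move=> y; have [->|yx] := eqVneq y x.
    by rewrite (_ : _ @^-1` _ = setT)//; apply/seteqP; split.
  rewrite (_ : _ @^-1` _ = set0)//; apply/seteqP; split=> // t /= xy.
  by move: yx; rewrite -xy eqxx.
- by exists (rnorm x).
Qed.

Lemma bochner_integral_cst (a b : R) (x : V) : a <= b ->
  bochner_integral a b (fun=> x) = of_real F (b - a) *: x.
Proof.
move=> ab; apply: (bochner_integral_lim hV (bounded_measurable_cst a b x)).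
rewrite (_ : (fun n => _) = fun=> of_real F (b - a) *: x); first exact: cvg_cst.
apply/funext => _; rewrite /simple_integral.
have -> : range (fun _ : R => x) = [set x].
  by apply/seteqP; split=> [_ [t _ <-]//|_ ->]; exists 0.
rewrite fsbig_set1 (_ : _ @^-1` _ = setT); last by apply/seteqP; split.
by rewrite setIT mu_itv.
Qed.

Lemma mean_cst k (x : V) t : 0 < k -> mean k (fun=> x) t = x.
Proof.
move=> k0; rewrite /mean /oriented_integral (ltW k0) bochner_integral_cst ?ltW//.
by rewrite subr0 scalerA -of_realM mulVf ?gt_eqF// of_real1 scale1r.
Qed.

Lemma meanD k f g t : 0 < k -> J t -> bounded_measurable_on f -> bounded_measurable_on g ->
  mean k (fun s => f s + g s) t = mean k f t + mean k g t.
Proof.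
move=> k0 Jt mf mg; rewrite !meanE//; last exact: bounded_measurable_onD.
by rewrite bochner_integralD ?scalerDr//; exact: bounded_measurable_tk.
Qed.

Lemma meanB k f g t : 0 < k -> J t -> bounded_measurable_on f -> bounded_measurable_on g ->
  mean k (fun s => f s - g s) t = mean k f t - mean k g t.
Proof.
move=> k0 Jt mf mg; rewrite !meanE//; last exact: bounded_measurable_onB.
by rewrite bochner_integralB ?scalerBr//; exact: bounded_measurable_tk.
Qed.

Lemma eq_mean k f g t : 0 < k -> (forall s, t <= s -> f s = g s) -> mean k f t = mean k g t.
Proof.
move=> k0 fg; rewrite /mean /oriented_integral (ltW k0); congr (_ *: _).
by apply: eq_bochner_integral => s s0 _; apply: fg; rewrite lerDl.
Qed.

Lemma mean_le k f t B : 0 < k -> J t -> bounded_measurable_on f ->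
  (forall s, t <= s -> s <= t + k -> rnorm (f s) <= B) -> rnorm (mean k f t) <= B.
Proof.
move=> k0 Jt mf fB; rewrite meanE// rnormZr gtr0_norm ?invr_gt0//.
rewrite ler_pdivrMl// mulrC; apply:
  le_trans (bochner_integral_le hV _ (bounded_measurable_tk mf k0 Jt) fB) _.
  by rewrite lerDl ltW.
by rewrite addrAC subrr add0r.
Qed.

Lemma bounded_measurable_on_cst (x : V) : bounded_measurable_on (fun=> x).
Proof. by move=> a b _ _; exists (fun _ _ => x); exact: bounded_measurable_cst. Qed.

Lemma mean_dist k f t (x : V) e : 0 < k -> J t -> bounded_measurable_on f ->
  (forall s, t <= s -> s <= t + k -> rnorm (f s - x) <= e) -> rnorm (mean k f t - x) <= e.
Proof.
move=> k0 Jt mf fe; rewrite -[X in _ - X](mean_cst x t k0) -meanB//; last exact: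
  bounded_measurable_on_cst.
by apply: mean_le => //; apply: bounded_measurable_onB => //; exact:
  bounded_measurable_on_cst.
Qed.

(** Two windows of equal length differ by two intervals of length [|s - t|]. *)
Lemma window_integral_lipschitz f k s t B : 0 < k -> J s -> J t ->
  bounded_measurable_on f ->
  (forall r, J r -> rnorm (f r) <= B) ->
  rnorm (bochner_integral s (s + k) f - bochner_integral t (t + k) f) <= 2 * B * `|s - t|.
Proof.
move=> k0 Js Jt mf fB; wlog st : s t Js Jt / s <= t.
  move=> H; have [/H|ts] := leP s t; first exact.
  by rewrite rdistC distrC; apply: H => //; exact: ltW.
have Jsk : J (s + k) by apply: upJ Js _; rewrite lerDl ltW.
have stk : s + k <= t + k by rewrite lerD2r.
have ssk : s <= s + k by rewrite lerDl ltW.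
have ttk : t <= t + k by rewrite lerDl ltW.
have E : bochner_integral s (s + k) f - bochner_integral t (t + k) f =
    bochner_integral s t f - bochner_integral (s + k) (t + k) f.
  apply/eqP; rewrite subr_eq addrAC -subr_eq opprK.
  have stk' := le_trans ssk stk; have stk'' := le_trans st ttk.
  rewrite -(bochner_integral_split hV ssk stk (mf _ _ Js stk')).
  by rewrite -(bochner_integral_split hV st ttk (mf _ _ Js stk'')).
rewrite E; apply: le_trans (rnormB _ _) _.
have h1 : rnorm (bochner_integral s t f) <= B * (t - s).
  apply: (bochner_integral_le hV st (mf _ _ Js st)) => r sr _.
  by apply: fB; exact: upJ sr.
have h2 : rnorm (bochner_integral (s + k) (t + k) f) <= B * (t - s).
  rewrite (_ : t - s = (t + k) - (s + k)); last by ring.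
  apply: (bochner_integral_le hV stk (mf _ _ Jsk stk)) => r sr _.
  by apply: fB; exact: upJ sr.
apply: le_trans (lerD h1 h2) _.
by rewrite distrC ger0_norm ?subr_ge0// -mulrA mulr_natl mulr2n.
Qed.

Lemma mean_BUC k f : 0 < k -> bounded_measurable_on f -> bounded_on J f -> BUC J (mean k f).
Proof.
move=> k0 mf [B fB]; split; last first.
  exists B => t Jt; apply: mean_le => // s ts _; apply: fB; exact: upJ ts.
move=> e e0.
pose C := `|B| + 1; have C0 : 0 < C by rewrite /C ltr_wpDl.
exists (e * k / (2 * C)); first by rewrite divr_gt0// mulr_gt0.
move=> s t Js Jt st; rewrite !meanE// -scalerBr rnormZr gtr0_norm ?invr_gt0//.
rewrite ltr_pdivrMl//.
have fC r : J r -> rnorm (f r) <= C.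
  by move=> /fB /le_trans; apply; have := ler_norm B; rewrite /C; lra.
apply: le_lt_trans (window_integral_lipschitz k0 Js Jt mf fC) _.
by rewrite mulrC -ltr_pdivlMr ?mulr_gt0// [k * e]mulrC.
Qed.

Lemma mean_translate k h f t : mean k (translate h f) t = mean k f (t + h).
Proof.
rewrite /mean; congr (_ *: oriented_integral _ _ _).
by apply/funext => s; rewrite /translate addrAC.
Qed.

End Means.

Section ScalarVector.
Variables (R : realType) (F : scalars) (V : normedModType (scalar_field R F)).
Hypothesis hV : seq_complete V.
Variable J : set R.
Hypothesis upJ : forall s t, J s -> s <= t -> J t.
Local Notation K := (scalar_module R F).
Implicit Types (g : R -> K).

Lemma bounded_approx_scale_vec a b g s (x : V) : bounded_approx a b g s ->
  bounded_approx a b (fun t => (g t : scalar_field R F) *: x)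
   (fun n t => (s n t : scalar_field R F) *: x).
Proof.
move=> [ss [M sM] sg]; split.
- by move=> n; exact: (simple_map_comp (fun c : K => (c : scalar_field R F) *: x) (ss n)).
- by exists (M * rnorm x) => n t; rewrite rnormZ ler_wpM2r// rnorm_ge0.
- apply: ae_sub sg => t H tab; have /cvg_rnormP {}H := H tab.
  apply/cvg_rnormP => e e0; pose C := rnorm x + 1.
  have C0 : 0 < C by rewrite /C ltr_wpDl// rnorm_ge0.
  have [N HN] := H (e / C) (divr_gt0 e0 C0); exists N => n /HN.
  rewrite ltr_pdivlMr// => h; rewrite -scalerBl (rnormZ (s n t - g t : K)).
  by apply: le_lt_trans h; rewrite ler_wpM2l ?rnorm_ge0// /C lerDl.
Qed.

Lemma bochner_integral_scale_vec a b g (x : V) : bounded_measurable a b g ->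
  bochner_integral a b (fun t => (g t : scalar_field R F) *: x) =
  (bochner_integral a b g : scalar_field R F) *: x.
Proof.
move=> [s hs]; apply: (bochner_integral_lim hV (bounded_approx_scale_vec x hs)).
have /cvg_rnormP H := bochner_integralP (@scalar_seq_complete R F) hs.
rewrite (_ : (fun n => _) = (fun n => (simple_integral a b (s n) : scalar_field R F) *: x)).
  apply/cvg_rnormP => e e0; pose C := rnorm x + 1.
  have C0 : 0 < C by rewrite /C ltr_wpDl// rnorm_ge0.
  have [N HN] := H (e / C) (divr_gt0 e0 C0); exists N => n /HN.
  rewrite ltr_pdivlMr// => h; rewrite -scalerBl (rnormZ (_ : K)).
  by apply: le_lt_trans h; rewrite ler_wpM2l ?rnorm_ge0// /C lerDl.
apply/funext => n; have [ss _ _] := hs.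
rewrite (simple_integral_comp (fun c : K => (c : scalar_field R F) *: x) a b (ss n)).
rewrite (_ : simple_integral a b (s n) = simple_integral a b (fun t => id (s n t)))//.
rewrite (simple_integral_comp id a b (ss n)) !(fsbig_finite _ _ (ss n).1) /=.
rewrite scaler_suml; apply: eq_bigr => c _.
by rewrite scalerA.
Qed.

Lemma mean_scale_vec k g (x : V) t : 0 < k -> J t -> bounded_measurable_on J g ->
  mean k (fun t => (g t : scalar_field R F) *: x) t =
  (mean k g t : scalar_field R F) *: x.
Proof.
move=> k0 Jt mg.
rewrite (meanE hV k0 _ Jt); last first.
  move=> a b Ja ab; have [s hs] := mg a b Ja ab.
  by exists (fun n t => (s n t : scalar_field R F) *: x); exact: bounded_approx_scale_vec.
rewrite (meanE (@scalar_seq_complete R F) k0 mg Jt).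
rewrite bochner_integral_scale_vec; last by apply: bounded_measurable_tk Jt.
by rewrite scalerA.
Qed.

(** Freezing [p] at the value [p t] costs [Gm * e] and leaves [p t] times the
mean of [g]. *)
Lemma mean_product k g (p : R -> V) t Gm e : 0 < k -> J t -> 0 <= e ->
  bounded_measurable_on J g -> bounded_measurable_on J (fun s => (g s : scalar_field R F)
    *: p s) ->
  (forall s, J s -> rnorm (g s) <= Gm) ->
  (forall s, t <= s -> s <= t + k -> rnorm (p s - p t) <= e) ->
  rnorm (mean k (fun s => (g s : scalar_field R F) *: p s) t) <=
    Gm * e + rnorm (mean k g t) * rnorm (p t).
Proof.
move=> k0 Jt e0 mg mgp gG pe.
have mgx : bounded_measurable_on J (fun s => (g s : scalar_field R F) *: p t).
  move=> a b Ja ab; have [s hs] := mg a b Ja ab.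
  by exists (fun n r => (s n r : scalar_field R F) *: p t); exact: bounded_approx_scale_vec.
rewrite -rnormZ -mean_scale_vec// -(subrK (mean k (fun s => (g s : scalar_field R F)
  *: p t) t) (mean k _ t)).
apply: le_trans (rnormD _ _) _; rewrite lerD2r -(meanB hV k0 Jt)//.
apply: (mean_le hV k0 Jt); first exact: bounded_measurable_onB.
move=> s ts stk; rewrite -scalerBr rnormZ ler_pM ?rnorm_ge0//; last exact: pe.
by apply: gG; exact: upJ ts.
Qed.

End ScalarVector.

(** * Algebra of uniformly continuous functions *)

Lemma invr_sub_factor (K : fieldType) (x y : K) : x != 0 -> y != 0 ->
  x^-1 - y^-1 = x^-1 * (y^-1 * (y - x)).
Proof. by move=> x0 y0; rewrite mulrBr mulVf// mulrBr mulr1 mulrCA mulVf// mulr1. Qed.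

Section Algebra.
Variables (R : realType) (F : scalars) (V : normedModType (scalar_field R F)).
Local Notation K := (scalar_module R F).
Implicit Types (S J : set R) (f g u v : R -> V) (c : R -> K).

Lemma BUC_sub (S S' : set R) f : S' `<=` S -> BUC S f -> BUC S' f.
Proof.
move=> SS [fu [B fB]]; split; last by exists B => t /SS; exact: fB.
move=> e e0; have [d d0 Hd] := fu e e0; exists d => // s t /SS Ss /SS St.
exact: Hd.
Qed.

Lemma eq_BUC S f g : (forall t, S t -> f t = g t) -> BUC S f -> BUC S g.
Proof.
move=> fg [fu [B fB]]; split; last by exists B => t St; rewrite -fg//; exact: fB.
move=> e e0; have [d d0 Hd] := fu e e0; exists d => // s t Ss St.
by rewrite -!fg//; exact: Hd.
Qed.

Lemma BUC_D S f g : BUC S f -> BUC S g -> BUC S (fun t => f t + g t).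
Proof.
move=> [fu [B fB]] [gu [B' gB]]; split; last first.
  by exists (B + B') => t St; rewrite (le_trans (rnormD _ _))// lerD// ?fB ?gB.
move=> e e0; have e20 : 0 < e / 2 by lra.
have [d d0 Hd] := fu _ e20; have [d' d'0 Hd'] := gu _ e20.
exists (Num.min d d') => [|s t Ss St]; first by rewrite lt_min d0.
rewrite lt_min => /andP[st st']; rewrite opprD addrACA (le_lt_trans (rnormD _ _))//.
by have := Hd s t Ss St st; have := Hd' s t Ss St st'; lra.
Qed.

Lemma BUC_scale S c f : BUC S c -> BUC S f ->
  BUC S (fun t => (c t : scalar_field R F) *: f t).
Proof.
move=> [cu [B0 cB0]] [fu [B'0 fB0]].
pose B : R := `|B0| + 1; pose B' : R := `|B'0| + 1.
have B0' : 0 < B by rewrite /B ltr_wpDl.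
have B'0' : 0 < B' by rewrite /B' ltr_wpDl.
have cB t : S t -> rnorm (c t) <= B.
  by move=> /cB0 /le_trans; apply; have := ler_norm B0; rewrite /B; lra.
have fB t : S t -> rnorm (f t) <= B'.
  by move=> /fB0 /le_trans; apply; have := ler_norm B'0; rewrite /B'; lra.
split; last first.
  by exists (B * B') => t St; rewrite rnormZ ler_pM ?rnorm_ge0// ?cB ?fB.
move=> e e0.
have [d d0 Hd] := cu (e / 2 / B') ltac:(by rewrite !divr_gt0).
have [d' d'0 Hd'] := fu (e / 2 / B) ltac:(by rewrite !divr_gt0).
exists (Num.min d d') => [|s t Ss St]; first by rewrite lt_min d0.
rewrite lt_min => /andP[st st'].
rewrite -(subrK ((c s : scalar_field R F) *: f t) (_ *: f s)) -addrA -scalerBr -scalerBl.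
apply: le_lt_trans (rnormD _ _) _; rewrite !rnormZ.
have h1 : rnorm (c s) * rnorm (f s - f t) <= B * rnorm (f s - f t).
  by rewrite ler_wpM2r ?rnorm_ge0// cB.
have h2 : rnorm (c s - c t) * rnorm (f t) <= rnorm (c s - c t) * B'.
  by rewrite ler_wpM2l ?rnorm_ge0// fB.
have h3 : B * rnorm (f s - f t) < e / 2.
  by rewrite mulrC -ltr_pdivlMr//; exact: Hd'.
have h4 : rnorm (c s - c t) * B' < e / 2.
  by rewrite -ltr_pdivlMr//; exact: Hd.
by have := lerD h1 h2; lra.
Qed.

Lemma BUC_inv S c (m : R) : 0 < m -> (forall t, S t -> m <= rnorm (c t)) -> BUC S c ->
  BUC S (fun t => (c t : scalar_field R F)^-1 : K).
Proof.
move=> m0 cm [cu _].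
have ci t : S t -> rnorm ((c t : scalar_field R F)^-1 : K) <= m^-1.
  move=> /cm h; rewrite rnormV lef_pV2 ?posrE//; exact: lt_le_trans h.
split; last by exists m^-1.
move=> e e0; have [d d0 Hd] := cu (e * m * m) ltac:(by rewrite !mulr_gt0).
exists d => // s t Ss St st.
have nz r : S r -> (c r : scalar_field R F) != 0.
  move=> /cm h; rewrite -(@rnorm_eq0 _ _ K) gt_eqF//; exact: lt_le_trans h.
have -> : ((c s : scalar_field R F)^-1 - (c t : scalar_field R F)^-1 : K) =
    ((c s : scalar_field R F)^-1 *: ((c t : scalar_field R F)^-1 *: (c t - c s : K))).
  exact: invr_sub_factor (nz _ Ss) (nz _ St).
rewrite (rnormZ ((c s : scalar_field R F)^-1 : K))
  (rnormZ ((c t : scalar_field R F)^-1 : K)).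
apply: (@le_lt_trans _ _ (m^-1 * (m^-1 * rnorm (c t - c s)))).
  rewrite ler_pM ?mulr_ge0 ?rnorm_ge0 ?ci//.
  by rewrite ler_wpM2r ?rnorm_ge0 ?ci.
rewrite !ltr_pdivrMl// rdistC mulrA mulrC mulrA; exact: Hd.
Qed.

Lemma BUC_B S f g : BUC S f -> BUC S g -> BUC S (fun t => f t - g t).
Proof.
move=> hf [gu [B gB]]; apply: BUC_D => //; split; last first.
  by exists B => t /gB; rewrite rnormN.
move=> e e0; have [d d0 Hd] := gu e e0; exists d => // s t Ss St st.
by rewrite -opprD rnormN; apply: Hd.
Qed.

Lemma BUC_translate J a f : (forall s t, J s -> s <= t -> J t) -> 0 <= a -> BUC J f ->
  BUC J (translate a f).
Proof.
move=> upJ a0 [fu [B fB]].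
have Ja t : J t -> J (t + a) by move=> /upJ; apply; rewrite lerDl.
split; last by exists B => t /Ja; exact: fB.
move=> e e0; have [d d0 Hd] := fu e e0; exists d => // s t /Ja Ss /Ja St st.
apply: Hd => //; by rewrite opprD addrACA subrr addr0.
Qed.

Lemma BUC_cont J f : BUC J f -> cont_on J f.
Proof. by case=> /unif_cont_on. Qed.

Lemma cont_onB J f g : cont_on J f -> cont_on J g -> cont_on J (fun t => f t - g t).
Proof.
move=> fc gc t Jt e e0; have e20 : 0 < e / 2 by lra.
have [d d0 Hd] := fc t Jt _ e20; have [d' d'0 Hd'] := gc t Jt _ e20.
exists (Num.min d d') => [|s Js]; first by rewrite lt_min d0.
rewrite lt_min => /andP[st st']; rewrite subrACA_sub (le_lt_trans (rnormB _ _))//.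
by have := Hd s Js st; have := Hd' s Js st'; lra.
Qed.

Lemma cont_onD J f g : cont_on J f -> cont_on J g -> cont_on J (fun t => f t + g t).
Proof.
move=> fc gc t Jt e e0; have e20 : 0 < e / 2 by lra.
have [d d0 Hd] := fc t Jt _ e20; have [d' d'0 Hd'] := gc t Jt _ e20.
exists (Num.min d d') => [|s Js]; first by rewrite lt_min d0.
rewrite lt_min => /andP[st st']; rewrite opprD addrACA (le_lt_trans (rnormD _ _))//.
by have := Hd s Js st; have := Hd' s Js st'; lra.
Qed.

Lemma eq_cont_on J f g : (forall t, J t -> f t = g t) -> cont_on J f -> cont_on J g.
Proof.
move=> fg fc t Jt e e0; have [d d0 Hd] := fc t Jt e e0; exists d => // s Js st.
by rewrite -!fg//; exact: Hd.
Qed.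

Lemma cont_on_scale J c f : cont_on J c -> bounded_on J c -> cont_on J f ->
  cont_on J (fun t => (c t : scalar_field R F) *: f t).
Proof.
move=> cc [B0 cB0] fc t Jt e e0.
pose B : R := `|B0| + 1; pose B' : R := rnorm (f t) + 1.
have B0' : 0 < B by rewrite /B ltr_wpDl.
have B'0' : 0 < B' by rewrite /B' ltr_wpDl ?rnorm_ge0.
have cB s : J s -> rnorm (c s) <= B.
  by move=> /cB0 /le_trans; apply; have := ler_norm B0; rewrite /B; lra.
have [d d0 Hd] := cc t Jt (e / 2 / B') ltac:(by rewrite !divr_gt0).
have [d' d'0 Hd'] := fc t Jt (e / 2 / B) ltac:(by rewrite !divr_gt0).
exists (Num.min d d') => [|s Js]; first by rewrite lt_min d0.
rewrite lt_min => /andP[st st'].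
rewrite -(subrK ((c s : scalar_field R F) *: f t) (_ *: f s)) -addrA -scalerBr -scalerBl.
apply: le_lt_trans (rnormD _ _) _; rewrite !rnormZ.
have h1 : rnorm (c s) * rnorm (f s - f t) <= B * rnorm (f s - f t).
  by rewrite ler_wpM2r ?rnorm_ge0// cB.
have h2 : rnorm (c s - c t) * rnorm (f t) <= rnorm (c s - c t) * B'.
  by rewrite ler_wpM2l ?rnorm_ge0// lerDl.
have h3 : B * rnorm (f s - f t) < e / 2.
  by rewrite mulrC -ltr_pdivlMr//; exact: Hd'.
have h4 : rnorm (c s - c t) * B' < e / 2.
  by rewrite -ltr_pdivlMr//; exact: Hd.
by have := lerD h1 h2; lra.
Qed.

Lemma bounded_onD J f g : bounded_on J f -> bounded_on J g ->
  bounded_on J (fun t => f t + g t).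
Proof.
move=> [B fB] [C gC]; exists (B + C) => t Jt.
by rewrite (le_trans (rnormD _ _))// lerD ?fB ?gC.
Qed.

Lemma bounded_onB J f g : bounded_on J f -> bounded_on J g ->
  bounded_on J (fun t => f t - g t).
Proof.
move=> [B fB] [C gC]; exists (B + C) => t Jt.
by rewrite (le_trans (rnormB _ _))// lerD ?fB ?gC.
Qed.

Lemma bounded_on_scale J c f : bounded_on J c -> bounded_on J f ->
  bounded_on J (fun t => (c t : scalar_field R F) *: f t).
Proof.
move=> [B cB] [C fC]; exists (B * C) => t Jt.
by rewrite rnormZ ler_pM ?rnorm_ge0 ?cB ?fC.
Qed.

Lemma bounded_onP J f : bounded_on J f ->
  exists2 B : R, 0 < B & forall t, J t -> rnorm (f t) <= B.
Proof.
move=> [B fB]; exists (`|B| + 1); first by rewrite ltr_wpDl.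
by move=> t /fB /le_trans; apply; have := ler_norm B; lra.
Qed.

End Algebra.

(** * Averaging the differences *)

(** Baire's theorem for countably many relatively closed sets that cover a
segment, with closedness stated as openness of the complement. *)
Lemma baire_cover (R : realType) (a b : R) (E : nat -> set R) : a < b ->
  (forall i h, a <= h -> h <= b -> ~ E i h -> exists2 d : R, 0 < d &
     forall h', a <= h' -> h' <= b -> `|h' - h| < d -> ~ E i h') ->
  (forall h, a <= h -> h <= b -> exists i, E i h) ->
  exists i x y, [/\ a <= x, x < y, y <= b & forall h, x <= h -> h <= y -> E i h].
Proof.
move=> ab Eo Ec; apply: contrapT => /forallNP H.
pose U i : set R := [set h | (a <= h <= b) -> ~ E i h].
have H' : forall i, open (U i) /\ dense (U i).
  move=> i; split.
    rewrite openE => h Uh.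
    have [hab|/negP] := boolP (a <= h <= b); last first.
      have o : open (~` `[a, b]%classic : set R) by apply: closed_openC; exact: itv_closed.
      move=> nhab; have : nbhs h (~` `[a, b]%classic).
        by apply: open_nbhs_nbhs; split => //=; rewrite in_itv.
      by apply: filterS => h' /=; rewrite in_itv/= => hh' /hh'.
    have /andP[ah hb] := hab.
    have [d d0 Hd] := Eo i h ah hb (Uh hab).
    apply/nbhs_ballP; exists d => // h' /= hh' /andP[ah' hb'].
    by apply: Hd => //; rewrite distrC.
  move=> O [x0 Ox0] oO; apply: contrapT => /forallNP ON.
  have OE h : O h -> (a <= h <= b) /\ E i h.
    move=> Oh; apply: contrapT => nh; apply: (ON h); split => // hab Eh.
    exact: nh.
  have := open_nbhs_nbhs (conj oO Ox0); move=> /nbhs_ballP[r /= r0 rO].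
  have in_ball h : x0 <= h -> h <= x0 + r / 2 -> O h.
    move=> h1 h2; apply: rO; rewrite /ball/= distrC ger0_norm ?subr_ge0//; lra.
  have [/andP[ax _] _] := OE x0 Ox0.
  have [/andP[_ yb] _] : (a <= x0 + r / 2 <= b) /\ E i (x0 + r / 2).
    apply: OE; apply: in_ball; lra.
  apply: (H i); exists x0, (x0 + r / 2); split => //; first lra.
  by move=> h h1 h2; have [] := OE h (in_ball h h1 h2).
have /(_ `]a, b[%classic) [] := @Baire R R U H'.
- exists ((a + b) / 2); rewrite /= in_itv/=; apply/andP; split; lra.
- exact: itv_open.
move=> h [/=]; rewrite in_itv/= => /andP[ah hb] Uh.
have [i Ei] := Ec h (ltW ah) (ltW hb).
by apply: (Uh i _ _ Ei) => //; rewrite !ltW.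
Qed.

Section Core.
Variables (R : realType) (F : scalars) (X : normedModType (scalar_field R F)).
Hypothesis hX : seq_complete X.
Variable J : set R.
Hypothesis upJ : forall s t, J s -> s <= t -> J t.
Local Notation K := (scalar_module R F).
Local Notation scalar := (scalar_field R F).
Implicit Types (f u v G : R -> X).

(** Write [f(t) = f(t + r) - (f(t + r) - f(t))] and integrate over [r] between
[0] and [1]. The first integral is Lipschitz in [t]; the second is sequentially
continuous by dominated convergence. *)
Lemma cont_of_differences f : bounded_measurable_on J f -> bounded_on J f ->
  (forall h, 0 < h -> cont_on J (difference h f)) -> cont_on J f.
Proof.
move=> mf fb dc t Jt e e0; apply: contrapT => H.
have [B B0 fB] := bounded_onP fb.
have Hn (n : nat) : exists s, [/\ J s, `|s - t| < n.+1%:R^-1 & e <= rnorm (f s - f t)].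
  apply: contrapT => /forallNP Hn; apply: H; exists n.+1%:R^-1; first by rewrite invr_gt0.
  move=> s Js st; apply: contrapT => /negP; rewrite -leNgt => fe.
  exact: (Hn s).
have [s Hs] := choice Hn.
have Js n : J (s n) by have [] := Hs n.
pose D n r := difference r f (s n) - difference r f t.
have mtr x : J x -> bounded_measurable 0 1 (translate x f).
  by move=> Jx; apply: bounded_measurable_translate; apply: mf; rewrite ?add0r// lerDr.
have m1 n : bounded_measurable 0 1 (fun r => translate (s n) f r - translate t f r).
  by apply: bounded_measurableB; apply: mtr.
have mc n : bounded_measurable 0 1 (fun=> f (s n) - f t).
  by exists (fun _ _ => f (s n) - f t); exact: bounded_measurable_cst.
have DE n : D n = (fun r => (translate (s n) f r - translate t f r) - (f (s n) - f t)).
  apply/funext => r; rewrite /D /difference /translate [s n + r]addrC [t + r]addrC.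
  exact: subrACA_sub.
have mD n : bounded_measurable 0 1 (D n) by rewrite DE; apply: bounded_measurableB.
have Jr x r : J x -> 0 <= r -> J (x + r) by move=> Jx r0; apply: upJ Jx _; rewrite lerDl.
have I0 : bochner_integral 0 1 (D n) @[n --> \oo] --> (0 : X).
  apply: (@bochner_integral_cvg0 _ _ _ hX _ _ _ (4 * B)) => //.
    move=> n r r0 r1; rewrite /D /difference.
    apply: le_trans (rnormB _ _) _.
    have := rnormB (f (s n + r)) (f (s n)); have := rnormB (f (t + r)) (f t).
    have := fB _ (Js n); have := fB _ Jt; have := fB _ (Jr _ _ (Js n) r0).
    by have := fB _ (Jr _ _ Jt r0); lra.
  move=> r; rewrite le_eqVlt => /orP[/eqP <- _|r0 r1].
    rewrite /D /difference (_ : (fun n => _) = fun=> 0); first exact: cvg_cst.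
    by apply/funext => n; rewrite !addr0 !subrr.
  apply/cvg_rnormP => d d0; have [d' d'0 Hd'] := dc r r0 t Jt d d0.
  exists (Num.truncn d'^-1) => n nN; rewrite subr0; apply: Hd' => //.
  have [_ st _] := Hs n; apply: lt_trans st _.
  rewrite -(invrK d') ltf_pV2 ?posrE ?invr_gt0//.
  by have := truncnS_gt d'^-1; move/lt_le_trans; apply; rewrite ler_nat.
have e20 : 0 < e / 2 by lra.
have [N HN] := (cvg_rnormP _ _).1 I0 _ e20.
pose d := e / 2 / (2 * B).
have d0 : 0 < d by rewrite /d !divr_gt0// mulr_gt0.
pose n := maxn N (Num.truncn d^-1).
have := HN n (leq_maxl _ _); rewrite subr0 DE.
rewrite (bochner_integralB hX (m1 n) (mc n))
  (bochner_integralB hX (mtr _ (Js n)) (mtr _ Jt)).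
rewrite bochner_integral_cst// subr0 of_real1 scale1r.
have tE x : J x -> bochner_integral 0 1 (translate x f) = bochner_integral x (x + 1) f.
  move=> Jx; rewrite [x + 1]addrC -[in RHS](add0r x)
    (bochner_integral_translate hX) ?add0r//.
  by apply: mf => //; rewrite lerDr.
rewrite !tE// => h1.
have h2 := window_integral_lipschitz hX upJ ltr01 (Js n) Jt mf fB.
have [_ st fe] := Hs n.
have h3 : 2 * B * `|s n - t| < e / 2.
  rewrite mulrC -ltr_pdivlMr ?mulr_gt0//; apply: lt_trans st _.
  rewrite -/d -(invrK d) ltf_pV2 ?posrE ?invr_gt0//.
  have := truncnS_gt d^-1; move/lt_le_trans; apply; rewrite ler_nat ltnS.
  exact: leq_maxr.
move: fe h1 h2; set I1 := bochner_integral _ _ _ - _; set fd := f _ - _ => fe h1 h2.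
have := rnormB I1 (I1 - fd); rewrite opprB addrC subrK; lra.
Qed.

(** A weakening of uniform continuity: one bound [e] for the oscillation, and
only far from the origin. *)
Definition modulus_at_infinity (e : R) f :=
  exists2 d : R, 0 < d & exists T : R, forall s t, J s -> J t ->
    T <= `|s| -> T <= `|t| -> `|s - t| < d -> rnorm (f s - f t) <= e.

Variables (gamma : R -> K) (c Gm : R).
Hypothesis c0 : 0 < c.
Hypothesis gamma_cont : cont_on J gamma.
Hypothesis gamma_ge : forall t, J t -> c <= rnorm (gamma t).
Hypothesis gamma_le : forall t, J t -> rnorm (gamma t) <= Gm.
Hypothesis gamma_mean0 : forall k e, 0 < k -> 0 < e -> exists T : R, forall t, J t ->
  T <= `|t| -> rnorm (mean k gamma t) <= e.

Lemma gamma_bounded_measurable : bounded_measurable_on J gamma.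
Proof. by apply: cont_bounded_measurable_on => //; exists Gm. Qed.

Lemma gamma_neq0 t : J t -> (gamma t : scalar) != 0.
Proof.
by move=> /gamma_ge h; rewrite -(@rnorm_eq0 _ _ K) gt_eqF//; apply: lt_le_trans h.
Qed.

Lemma rnorm_gammaV t x : J t -> rnorm ((gamma t : scalar)^-1 *: x) <= c^-1 * rnorm (x : X).
Proof.
move=> Jt; rewrite (rnormZ ((gamma t : scalar)^-1 : K)) rnormV ler_wpM2r ?rnorm_ge0//.
by rewrite lef_pV2 ?posrE//; [exact: gamma_ge|apply: lt_le_trans (gamma_ge Jt)].
Qed.

Lemma Gm_gt0 t : J t -> 0 < Gm.
Proof. by move=> Jt; apply: lt_le_trans (gamma_le Jt); apply:
  lt_le_trans (gamma_ge Jt). Qed.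

Lemma Jadd t r : J t -> 0 <= r -> J (t + r).
Proof. by move=> Jt r0; apply: upJ Jt _; rewrite lerDl. Qed.

Lemma BUC_bounded_measurable f : BUC J f -> bounded_measurable_on J f.
Proof. by move=> [fu fb]; apply: cont_bounded_measurable_on => //; exact: unif_cont_on. Qed.

(** When [f] differs from its translate by [u + gamma v], this quantity is close
to [v] at infinity for small [k]. *)
Definition quotient k f h t :=
  (gamma t : scalar)^-1 *: difference h (fun s => f s - mean k f s) t.

(** Means commute with differences, so the quotient equals [v + (u - M_k u) /
gamma - M_k (gamma v) / gamma]; uniform continuity controls the middle term and
vanishing of [M_k gamma] the last one. *)
Lemma quotient_modulus f h e u v : bounded_measurable_on J f -> bounded_on J f ->
  0 < h -> 0 < e ->
  BUC J u -> BUC J v -> (forall t, J t -> difference h f t =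
    u t + (gamma t : scalar) *: v t) ->
  exists2 k0 : R, 0 < k0 & forall k, 0 < k -> k < k0 ->
    modulus_at_infinity e (quotient k f h).
Proof.
move=> mf fb h0 e0 hu hv E.
have [/existsNP [t0 /contrapT Jt0]|noJ] := pselect (~ forall t, ~ J t); last first.
  exists 1 => // k _ _; exists 1 => //; exists 0 => s t Js.
  by have := noJ (fun H => H s Js).
have G0 := Gm_gt0 Jt0.
have [Bv Bv0 vB] := bounded_onP hv.2.
(* The three error terms add up to [(Gm + 2) * eta], and division by [gamma]
   costs a factor [1 / c]; the result is [e / 4]. *)
pose eta := e * c / (4 * (Gm + 2)).
have eta0 : 0 < eta by rewrite /eta divr_gt0 ?mulr_gt0// addr_gt0.
have [d1 d10 Hd1] := hu.1 eta eta0; have [d2 d20 Hd2] := hv.1 eta eta0.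
exists (Num.min d1 d2); first by rewrite lt_min d10.
move=> k k0; rewrite lt_min => /andP[kd1 kd2].
have [d3 d30 Hd3] := hv.1 (e / 4) ltac:(lra).
exists d3 => //.
have [T HT] := gamma_mean0 k0 (divr_gt0 eta0 Bv0).
exists T.
have mu' := BUC_bounded_measurable hu; have mv := BUC_bounded_measurable hv.
have mgv : bounded_measurable_on J (fun t => (gamma t : scalar) *: v t).
  apply: cont_bounded_measurable_on => //; first by apply: cont_on_scale;
    [|exists Gm|apply: BUC_cont].
  by apply: bounded_on_scale; [exists Gm|exact: hv.2].
have close t : J t -> T <= `|t| -> rnorm (quotient k f h t - v t) <= e / 4.
  move=> Jt Tt.
  have -> : quotient k f h t - v t =
    (gamma t : scalar)^-1 *: ((u t - mean k u t)
      - mean k (fun s => (gamma s : scalar) *: v s) t).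
    have qE : difference h (fun s => f s - mean k f s) t =
        (u t + (gamma t : scalar) *: v t) -
        (mean k u t + mean k (fun s => (gamma s : scalar) *: v s) t).
      rewrite -E// -(meanD hX k0 Jt mu' mgv) /difference subrACA_sub; congr (_ - _).
      have mt : bounded_measurable_on J (translate h f).
        move=> a b Ja ab; apply: bounded_measurable_translate; apply: mf;
          last by rewrite lerD2r.
        by apply: Jadd => //; exact: ltW.
      rewrite -mean_translate -(meanB hX k0 Jt mt mf).
      by apply: eq_mean => // s ts; rewrite -E//; exact: upJ ts.
    rewrite /quotient -[X in _ - X = _](scalerK (gamma_neq0 Jt)) -scalerBr qE;
      congr (_ *: _).
    by rewrite addrAC addrK opprD addrA.
  apply: le_trans (rnorm_gammaV _ Jt) _.
  rewrite ler_pdivrMl//.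
  apply: le_trans (rnormB _ _) _.
  have h1 : rnorm (u t - mean k u t) <= eta.
    rewrite rdistC; apply: (mean_dist hX k0 Jt mu') => s ts stk.
    apply/ltW/Hd1 => //; first exact: upJ ts.
    by rewrite ger0_norm ?subr_ge0//; lra.
  have h2 : rnorm (mean k (fun s => (gamma s : scalar) *: v s) t) <= Gm * eta + eta.
    apply: le_trans (mean_product hX upJ k0 Jt (ltW eta0)
      gamma_bounded_measurable mgv gamma_le _) _.
      move=> s ts stk; apply/ltW/Hd2 => //; first exact: upJ ts.
      by rewrite ger0_norm ?subr_ge0//; lra.
    rewrite lerD2l; have := HT t Jt Tt; rewrite ler_pdivlMr//; apply: le_trans.
    by rewrite ler_wpM2l ?rnorm_ge0// vB.
  apply: le_trans (lerD h1 h2) _.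
  have -> : eta + (Gm * eta + eta) = (Gm + 2) * eta by ring.
  rewrite /eta (_ : (Gm + 2) * _ = c * (e / 4))//.
  by field; apply: lt0r_neq0; lra.
move=> s t Js Jt Ts Tt st.
have := close s Js Ts; have := close t Jt Tt; have := Hd3 s t Js Jt st.
have := rdist_tri (v s) (quotient k f h s) (quotient k f h t).
have := rdist_tri (v t) (v s) (quotient k f h t).
rewrite (rdistC (v t)); lra.
Qed.

Lemma bounded_measurable_quotient f k t (a b : R) :
  bounded_measurable_on J (fun s => f s - mean k f s) -> J t ->
  0 <= a -> a <= b -> bounded_measurable a b (fun h => quotient k f h t).
Proof.
move=> mq Jt a0 ab; apply: bounded_measurableZ; apply: bounded_measurableB; last first.
  by exists (fun _ _ => f t - mean k f t); exact: bounded_measurable_cst.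
have : bounded_measurable a b (translate t (fun s => f s - mean k f s)).
  apply: bounded_measurable_translate; apply: mq; last by rewrite lerD2r.
  by rewrite addrC; apply: Jadd.
by apply: eq_bounded_measurable => h _ _; rewrite /translate [h + t]addrC.
Qed.

Lemma quotient_cont f k t h e : cont_on J (fun s => f s - mean k f s) -> J t -> 0 <= h ->
  0 < e ->
  exists2 d : R, 0 < d & forall h', 0 <= h' -> `|h' - h| < d ->
    rnorm (quotient k f h' t - quotient k f h t) < e.
Proof.
move=> qc Jt h0 e0.
have [d d0 Hd] := qc (t + h) (Jadd Jt h0) (c * e) (mulr_gt0 c0 e0).
exists d => // h' h'0 hh'; rewrite /quotient -scalerBr.
apply: le_lt_trans (rnorm_gammaV _ Jt) _.
rewrite ltr_pdivrMl// /difference subrACA_sub subrr subr0; apply: Hd; first exact: Jadd.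
by rewrite opprD addrACA subrr add0r.
Qed.

(** Averaging [q(t) = q(t + h) - gamma(t) Q_h(t)] over [h] between [a] and [b],
where [q = f - M_k f] and [Q_h] is the quotient, gives a mean of [q] minus
[gamma] times an average of functions with modulus [e]; convexity keeps the
modulus. *)
Lemma average_approx f k (a b e : R) : 0 < k -> 0 < a -> a < b ->
  cont_on J f -> bounded_on J f ->
  (exists2 d : R, 0 < d & exists T : R, forall h, a <= h -> h <= b ->
    forall s t, J s -> J t -> T <= `|s| -> T <= `|t| -> `|s - t| < d ->
    rnorm (quotient k f h s - quotient k f h t) <= e) ->
  exists2 G, BUC J G & modulus_at_infinity e (fun t => (gamma t : scalar)^-1 *: (f t - G
    t)).
Proof.
move=> k0 a0 ab fc fb [d d0 [T HT]].
have mf : bounded_measurable_on J f by apply: cont_bounded_measurable_on.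
pose q s := f s - mean k f s.
have hM : BUC J (mean k f) by apply: mean_BUC.
have qc : cont_on J q by apply: cont_onB => //; exact: BUC_cont.
have qb : bounded_on J q by apply: bounded_onB => //; case: hM.
have mq : bounded_measurable_on J q by apply: cont_bounded_measurable_on.
have l0 : 0 < b - a by rewrite subr_gt0.
have hA : BUC J (translate a (mean (b - a) q)).
  exact: (BUC_translate upJ (ltW a0) (mean_BUC hX upJ l0 mq qb)).
exists (fun t => mean k f t + translate a (mean (b - a) q) t); first exact: BUC_D.
have E t : J t -> (gamma t : scalar)^-1 *:
    (f t - (mean k f t + translate a (mean (b - a) q) t)) =
    - (of_real F (b - a)^-1 *: bochner_integral a b (fun h => quotient k f h t)).
  move=> Jt; have Jta : J (t + a) by apply: Jadd => //; exact: ltW.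
  have mt : bounded_measurable a b (translate t q).
    by apply: bounded_measurable_translate; apply: mq; rewrite ?lerD2r ?ltW// addrC.
  have mc : bounded_measurable a b (fun=> q t) by exists (fun _ _ => q t); exact:
    bounded_measurable_cst.
  have -> : bochner_integral a b (fun h => quotient k f h t) = (gamma t : scalar)^-1 *:
      (bochner_integral a b (translate t q) - of_real F (b - a) *: q t).
    rewrite -(bochner_integral_cst hX (q t) (ltW ab)) -(bochner_integralB hX mt mc).
    rewrite -(bochner_integralZ hX _ (bounded_measurableB mt mc)).
    apply: eq_bochner_integral => h _ _; congr (_ *: _).
    by rewrite /difference /translate /q [h + t]addrC.
  rewrite scalerA mulrC -scalerA -scalerN; congr (_ *: _).
  rewrite scalerBr scalerA -of_realM mulVf ?gt_eqF// of_real1 scale1r opprB opprD addrA.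
  congr (_ - _); rewrite {1}/translate (meanE hX l0 mq Jta); congr (_ *: _).
  rewrite (bochner_integral_translate hX).
    by congr bochner_integral; ring.
  by apply: mq; rewrite ?lerD2r ?ltW// addrC.
exists d => //; exists T => s t Js Jt Ts Tt st; rewrite !E//.
have ms : bounded_measurable a b (fun h => quotient k f h s) by apply:
  bounded_measurable_quotient => //; exact: ltW.
have mt : bounded_measurable a b (fun h => quotient k f h t) by apply:
  bounded_measurable_quotient => //; exact: ltW.
rewrite -opprD rnormN -scalerBr -(bochner_integralB hX ms mt) rnormZr gtr0_norm ?invr_gt0//.
rewrite ler_pdivrMl// mulrC; apply: (bochner_integral_le hX (ltW ab)); first exact:
  bounded_measurableB.
by move=> h ah hb; apply: HT.
Qed.

Definition sum_class_differences f := forall h, 0 < h -> exists u v,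
  [/\ BUC J u, BUC J v & forall t, J t -> difference h f t =
    u t + (gamma t : scalar) *: v t].

(** For each [h] between [1] and [2] the quotient has modulus [e] at infinity
for some [k = 1 / (m + 1)] and some distance parameter [n]. These conditions are
closed in [h], so one pair [(m, n)] serves a whole interval of values of [h]. *)
Lemma approx_by_BUC f e : cont_on J f -> bounded_on J f -> sum_class_differences f ->
  0 < e ->
  exists2 G, BUC J G & modulus_at_infinity e (fun t => (gamma t : scalar)^-1 *: (f t - G
    t)).
Proof.
move=> fc fb df e0.
have mf : bounded_measurable_on J f by apply: cont_bounded_measurable_on.
have kpos (m : nat) : 0 < m.+1%:R^-1 :> R by rewrite invr_gt0.
(* [E] is indexed by [nat] through an encoding of the pairs [(m, n)]; indices
   that encode no pair give the empty set. *)
pose E i : set R := [set h | if (unpickle i : option (nat * nat)) is Some p then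
  forall s t, J s -> J t -> p.2%:R <= `|s| -> p.2%:R <= `|t| -> `|s - t| < p.2.+1%:R^-1 ->
    rnorm (quotient p.1.+1%:R^-1 f h s - quotient p.1.+1%:R^-1 f h t) <= e else False].
have [] := @baire_cover R 1 2 E.
- by rewrite ltr1n.
- move=> i h h1 h2; rewrite /E/=; case: (unpickle i) => [[m n]/=|_]; last first.
    by exists 1 => // h' _ _ _ [].
  move=> /existsNP[s /existsNP[t]].
  move=> /not_implyP[Js /not_implyP[Jt /not_implyP[Ts /not_implyP[Tt /not_implyP[st
    /negP]]]]].
  rewrite -ltNge => gap; set k := m.+1%:R^-1 in gap *.
  have qc : cont_on J (fun s => f s - mean k f s).
    by apply: cont_onB => //; apply: BUC_cont; apply: mean_BUC => //; exact: kpos.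
  set Q := quotient k f in gap *.
  have eta0 : 0 < (rnorm (Q h s - Q h t) - e) / 2 by rewrite divr_gt0// subr_gt0.
  have h0 : 0 <= h by lra.
  have [d d0 Hd] := quotient_cont qc Js h0 eta0.
  have [d' d'0 Hd'] := quotient_cont qc Jt h0 eta0.
  exists (Num.min d d') => [|h' h'1 h'2]; first by rewrite lt_min d0.
  rewrite lt_min => /andP[hd hd'] /(_ s t Js Jt Ts Tt st); rewrite -/k -/Q => Q'.
  have h'0 : 0 <= h' by lra.
  have := Hd h' h'0 hd; have := Hd' h' h'0 hd'; rewrite -/Q.
  have := rdist_tri (Q h' s) (Q h s) (Q h t).
  have := rdist_tri (Q h' t) (Q h' s) (Q h t).
  rewrite (rdistC (Q h s) (Q h' s)); move: gap Q'; clear; lra.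
- move=> h h1 h2; have h0 : 0 < h by lra.
  have [u [v [hu hv Euv]]] := df h h0.
  have [k0 k00 Hk] := quotient_modulus mf fb h0 e0 hu hv Euv.
  pose m := Num.truncn k0^-1.
  have mk : m.+1%:R^-1 < k0.
    by rewrite -(invrK k0) ltf_pV2 ?posrE ?invr_gt0//; exact: truncnS_gt.
  have [d d0 [T HT]] := Hk _ (kpos m) mk.
  pose n := maxn (Num.truncn d^-1) (Num.truncn `|T|).+1.
  exists (pickle (m, n)); rewrite /E/= pickleK => s t Js Jt Ts Tt st.
  have Tn : T <= n%:R.
    apply: le_trans (ler_norm _) _; apply/ltW.
    apply: lt_le_trans (truncnS_gt _) _; rewrite ler_nat; exact: leq_maxr.
  apply: HT => //; [exact: le_trans Ts|exact: le_trans Tt|].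
  apply: lt_trans st _; rewrite -(invrK d) ltf_pV2 ?posrE ?invr_gt0//.
  apply: lt_le_trans (truncnS_gt _) _; rewrite ler_nat ltnS; exact: leq_maxl.
move=> i [a [b [a1 ab b2 Hab]]]; have := Hab a (lexx _) (ltW ab).
rewrite /E/=; case Ei : (unpickle i) => [[m n]|]// _.
apply: (@average_approx f m.+1%:R^-1 a b) => //; first lra.
exists n.+1%:R^-1; first exact: kpos.
exists n%:R => h ah hb; have := Hab h ah hb; rewrite /E/= Ei; exact.
Qed.

Lemma modulus_at_infinityB e e' f g : modulus_at_infinity e f -> modulus_at_infinity e' g ->
  modulus_at_infinity (e + e') (fun t => f t - g t).
Proof.
move=> [d d0 [T HT]] [d' d'0 [T' HT']]; exists (Num.min d d'); first by rewrite lt_min d0.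
exists (Num.max T T') => s t Js Jt; rewrite !ge_max lt_min.
move=> /andP[Ts T's] /andP[Tt T't] /andP[st st'].
rewrite subrACA_sub (le_trans (rnormB _ _))// lerD//; [exact: HT|exact: HT'].
Qed.

(** Here [W] is compared with [M_k W]: they are close by uniform continuity, and
the mean of [W = gamma (W / gamma)] is small because [W / gamma] hardly varies
over a window while [M_k gamma] vanishes. *)
Lemma small_at_infinity W e : BUC J W -> 0 < e ->
  modulus_at_infinity e (fun t => (gamma t : scalar)^-1 *: W t) ->
  exists T : R, forall t, J t -> T <= `|t| -> rnorm (W t) <= (Gm + 2) * e.
Proof.
move=> hW e0 [d d0 [T HT]]; have [d' d'0 Hd'] := hW.1 e e0.
have [B B0 WB] := bounded_onP hW.2.
pose k := Num.min (Num.min d d') 1 / 2.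
have m0 : 0 < Num.min (Num.min d d') 1 by rewrite !lt_min d0 d'0/=.
have k0 : 0 < k by rewrite divr_gt0.
have [kd kd' k1] : [/\ k < d, k < d' & k < 1].
  have km : k < Num.min (Num.min d d') 1 by rewrite /k ltr_pdivrMr// ltr_pMr// ltr1n.
  by move: km; rewrite !lt_min => /andP[/andP[-> ->] ->].
have P0 : 0 < c^-1 * B by rewrite mulr_gt0// invr_gt0.
have [T' HT'] := gamma_mean0 k0 (divr_gt0 e0 P0).
exists (Num.max T' (T + 1)) => t Jt; rewrite ge_max => /andP[T't Tt].
have mW := BUC_bounded_measurable hW.
have WE s : J s -> W s = (gamma s : scalar) *: ((gamma s : scalar)^-1 *: W s).
  by move=> Js; rewrite scalerA divff ?scale1r//; exact: gamma_neq0.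
have mW' : bounded_measurable_on J (fun s => (gamma s : scalar)
  *: ((gamma s : scalar)^-1 *: W s)).
  by apply: (eq_bounded_measurable_on upJ _ mW).
have near_t s : t <= s -> s <= t + k -> `|s - t| <= k.
  by move=> ts stk; rewrite ger0_norm ?subr_ge0// lerBlDl.
have h1 : rnorm (mean k W t - W t) <= e.
  apply: (mean_dist hX k0 Jt mW) => s ts stk; apply/ltW/Hd' => //; first exact: upJ ts.
  exact: le_lt_trans (near_t s ts stk) _.
have h2 : rnorm (mean k W t) <= Gm * e + e.
  rewrite (eq_mean k0 (fun s ts => WE s (upJ Jt ts))).
  apply: le_trans (mean_product hX upJ k0 Jt (ltW e0)
    gamma_bounded_measurable mW' gamma_le _) _.
    move=> s ts stk; have st := near_t s ts stk.
    apply: HT => //; first exact: upJ ts; last by apply: le_lt_trans st _.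
      have := ler_normB s (s - t); rewrite opprB addrC subrK; lra.
    by apply: le_trans Tt; rewrite lerDl.
  rewrite lerD2l; have := HT' t Jt T't; rewrite ler_pdivlMr//; apply: le_trans.
  rewrite ler_wpM2l ?rnorm_ge0//; apply: le_trans (rnorm_gammaV _ Jt) _.
  by rewrite ler_wpM2l ?invr_ge0 ?(ltW c0)// WB.
rewrite -(subrK (mean k W t) (W t)); apply: le_trans (rnormD _ _) _.
rewrite rdistC; apply: le_trans (lerD h1 h2) _.
by rewrite (_ : (Gm + 2) * e = e + (Gm * e + e))//; ring.
Qed.

End Core.

(** * Gluing the approximations *)

Section Gluing.
Variables (R : realType) (F : scalars) (X : normedModType (scalar_field R F)).
Hypothesis hX : seq_complete X.
Variable J : set R.
Implicit Types (f u v G : R -> X).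

Lemma half_pow_small (C e : R) : 0 < C -> 0 < e -> exists n : nat, C * 2^-1 ^+ n < e.
Proof.
move=> C0 e0; pose n := Num.truncn (C / e); exists n.
rewrite exprVn ltr_pdivrMr ?exprn_gt0// mulrC -ltr_pdivrMr//.
apply: lt_le_trans (truncnS_gt _) _.
by rewrite -natrX ler_nat ltn_expl.
Qed.

Definition cutoff (T t : R) : R := Num.max 0 (Num.min 1 (`|t| - T)).

Lemma cutoff_itv T t : 0 <= cutoff T t <= 1.
Proof. by rewrite /cutoff le_max lexx ge_max ler01/= ge_min lexx. Qed.

Lemma cutoff_eq0 T t : `|t| <= T -> cutoff T t = 0.
Proof. by move=> tT; rewrite /cutoff max_l// ge_min subr_le0 tT orbT. Qed.

Lemma cutoff_eq1 T t : T + 1 <= `|t| -> cutoff T t = 1.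
Proof.
by move=> tT; rewrite /cutoff min_l ?max_r// lerBrDl.
Qed.

Lemma cutoff_lip T s t : `|cutoff T s - cutoff T t| <= `|s - t|.
Proof.
have := ler_dist_dist s t; rewrite ler_norml => /andP[h1 h2].
rewrite /cutoff; case: (leP 1 (`|s| - T)) => hs; case: (leP 1 (`|t| - T)) => ht;
  rewrite ler_norml; apply/andP; split; have := normr_ge0 (s - t);
  rewrite ?(max_r ler01);
  (case: (leP 0 (`|s| - T)) => hs0); (case: (leP 0 (`|t| - T)) => ht0); lra.
Qed.

Lemma cutoff_BUC T : BUC J (fun t => of_real F (cutoff T t) : scalar_module R F).
Proof.
split; last first.
  exists 1 => t _; rewrite rnorm_of_real; have /andP[h0 h1] := cutoff_itv T t.
  by rewrite ger0_norm.
move=> e e0; exists e => // s t _ _ st.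
rewrite -of_realN -of_realD rnorm_of_real; exact: le_lt_trans (cutoff_lip _ _ _) st.
Qed.

Lemma BUC_uniform_limit u : (forall e : R, 0 < e -> exists2 g : R -> X, BUC J g &
  forall t, J t -> rnorm (u t - g t) <= e) -> BUC J u.
Proof.
move=> H; split; last first.
  have [g [_ [B gB]] ug] := H 1 ltr01; exists (1 + B) => t Jt.
  by rewrite -(subrK (g t) (u t)) (le_trans (rnormD _ _))// lerD ?ug ?gB.
move=> e e0; have [g [gamma_le _] ug] := H (e / 4) ltac:(lra).
have [d d0 Hd] := gamma_le (e / 4) ltac:(lra).
exists d => // s t Js Jt st.
have := ug s Js; have := ug t Jt; have := Hd s t Js Jt st.
have := rdist_tri (g s) (u s) (u t); have := rdist_tri (g t) (g s) (u t).
rewrite (rdistC (g t) (u t)); move: e0; clear; lra.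
Qed.

(** Telescoping series: multiplying [G (n + 1) - G n] by a cutoff makes the
bound valid everywhere while the partial sum [U n] still agrees with [G n] far
out. *)
Lemma glue (G : nat -> R -> X) (A : R) : 0 < A -> (forall n, BUC J (G n)) ->
  (forall n, exists T : R, forall t, J t -> T <= `|t| ->
     rnorm (G n.+1 t - G n t) <= A * 2^-1 ^+ n) ->
  exists2 u, BUC J u & forall n, exists T : R, forall t, J t -> T <= `|t| ->
     rnorm (u t - G n t) <= 2 * A * 2^-1 ^+ n.
Proof.
move=> A0 GB Gc; have [T HT] := choice Gc.
pose H n t := of_real F (cutoff (T n) t) *: (G n.+1 t - G n t).
have HB n : BUC J (H n).
  by apply: (BUC_scale (cutoff_BUC (T n))); apply: BUC_B.
have Hle n t : J t -> rnorm (H n t) <= A * 2^-1 ^+ n.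
  move=> Jt; have a0 : 0 <= A * 2^-1 ^+ n by rewrite mulr_ge0 ?exprn_ge0// ltW.
  rewrite /H; have [tT|tT] := leP `|t| (T n);
    first by rewrite cutoff_eq0// of_real0 scale0r rnorm0.
  have /andP[h0 h1] := cutoff_itv (T n) t.
  rewrite rnormZr ger0_norm//; apply: le_trans (HT n t Jt (ltW tT)).
  by rewrite ler_piMl ?rnorm_ge0.
pose U := fix U n t := if n is m.+1 then U m t + H m t else G 0%N t.
have UB n : BUC J (U n) by elim: n => [|n IH]; [exact: GB|apply: BUC_D].
have UG n : exists T' : R, forall t, T' <= `|t| -> U n t = G n t.
  elim: n => [|n [T' IH]]; first by exists 0.
  exists (Num.max T' (T n + 1)) => t; rewrite ge_max => /andP[t1 t2].
  by rewrite /= IH// /H cutoff_eq1// of_real1 scale1r addrC subrK.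
have Uc n m t : J t -> rnorm (U (n + m)%N t - U n t)
  <= 2 * A * 2^-1 ^+ n - 2 * A * 2^-1 ^+ (n + m).
  move=> Jt; elim: m => [|m IH]; first by rewrite addn0 !subrr rnorm0.
  rewrite addnS /= addrAC; apply: le_trans (rnormD _ _) _.
  have := Hle (n + m)%N t Jt; rewrite exprS; lra.
have Uc' n m t : J t -> (n <= m)%N -> rnorm (U m t - U n t) <= 2 * A * 2^-1 ^+ n.
  move=> Jt nm; rewrite -(subnKC nm); apply: le_trans (Uc _ _ _ Jt) _.
  by rewrite lerBlDr lerDl !mulr_ge0 ?exprn_ge0// ltW.
have small e : 0 < e -> exists n : nat, 2 * A * 2^-1 ^+ n < e.
  by move=> e0; apply: half_pow_small => //; rewrite mulr_gt0.
have ex t : exists x : X, J t -> U n t @[n --> \oo] --> x.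
  have [Jt|nJ] := pselect (J t); last by exists 0.
  have [|x Hx] := hX (_ : seq_cauchy (fun n => U n t)); last by exists x.
  move=> e e0; have [N HN] := small (e / 2) ltac:(lra); exists N => n m Nn Nm.
  have := Uc' N n t Jt Nn; have := Uc' N m t Jt Nm.
  have := rdist_tri (U N t) (U n t) (U m t); rewrite (rdistC (U N t)); lra.
have [u Hu] := choice ex.
have uU n t : J t -> rnorm (u t - U n t) <= 2 * A * 2^-1 ^+ n.
  move=> Jt; have /cvg_rnormP ut := Hu t Jt.
  apply/ler_addgt0Pr => e e0; have [N HN] := ut e e0.
  have := HN _ (leq_maxl N n); have := Uc' n (maxn N n) t Jt (leq_maxr _ _).
  have := rdist_tri (U (maxn N n) t) (u t) (U n t).
  rewrite (rdistC (u t) (U (maxn N n) t)); lra.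
exists u.
  apply: BUC_uniform_limit => e e0; have [n Hn] := small e e0.
  exists (U n) => // t Jt; apply: le_trans (uU n t Jt) (ltW Hn).
move=> n; have [T' HT'] := UG n; exists T' => t Jt Tt.
by rewrite -HT'//; exact: uU.
Qed.

End Gluing.

(** * Uniform continuity near the left end and at infinity *)

Section LocalUniformContinuity.
Variables (R : realType) (F : scalars) (V : normedModType (scalar_field R F)).
Variable J : set R.
Hypothesis hJ : admissible_interval J.
Implicit Types (f g : R -> V).

Lemma admissible_up s t : J s -> s <= t -> J t.
Proof.
case: hJ => [[a ->]|[a ->]|->]//=; rewrite !in_itv/= !andbT.
  exact: le_trans.
exact: lt_le_trans.
Qed.

Lemma admissible_nonempty : exists t, J t.
Proof.
case: hJ => [[a ->]|[a ->]|->]; last by exists 0.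
  by exists a; rewrite /= in_itv/= lexx.
by exists (a + 1); rewrite /= in_itv/= ltrDl ltr01.
Qed.

Definition window (T : R) : set R := [set t | J t /\ `|t| <= T].

(** The translate of [window T] stays away from the left end of [J] even if that
end is open, so it lies in a compact segment of [J]. *)
Lemma shifted_window (a T : R) : 0 < a -> exists lo hi : R, `[lo, hi]%classic `<=` J /\
  forall t, window T t -> `[lo, hi]%classic (t + a).
Proof.
move=> a0; suff [lo Jlo lot] : exists2 lo, (forall s, lo <= s -> J s) &
    forall t, window T t -> lo <= t + a.
  exists lo, (T + a); split=> [t /=|t tT]; first by rewrite in_itv/= => /andP[/Jlo].
  rewrite /= in_itv/= lot//= lerD2r; have [_ ] := tT; exact: le_trans (ler_norm _).
case: hJ => [[al E]|[al E]|E].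
- exists al => [s|t [Jt _]]; first by rewrite E/= in_itv/= andbT.
  by move: Jt; rewrite E/= in_itv/= andbT; lra.
- exists (al + a) => [s|t [Jt _]]; first by rewrite E/= in_itv/= andbT; lra.
  by move: Jt; rewrite E/= in_itv/= andbT; lra.
- exists (- T) => [s|t [_]]; first by rewrite E.
  by rewrite ler_norml => /andP[h _]; lra.
Qed.

Lemma translate_local_BUC f (a T : R) : 0 < a -> cont_on J f -> bounded_on J f ->
  BUC (window T) (translate a f).
Proof.
move=> a0 fc [B fB]; have [lo [hi [sJ Hw]]] := shifted_window T a0.
have fu := cont_unif_segment (cont_on_sub sJ fc).
split; last by exists B => t /Hw /sJ; exact: fB.
move=> e e0; have [d d0 Hd] := fu e e0; exists d => // s t /Hw Ss /Hw St st.
by apply: Hd => //; rewrite opprD addrACA subrr addr0.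
Qed.

Lemma unif_continuous_from_local f :
  (forall e, 0 < e -> modulus_at_infinity J e f) ->
  (forall T, unif_continuous_on (window T) f) -> unif_continuous_on J f.
Proof.
move=> Hi Hl e e0; have e20 : 0 < e / 2 by lra.
have [d d0 [T HT]] := Hi _ e20; have [d' d'0 Hd'] := Hl (T + 1) e e0.
exists (Num.min 1 (Num.min d d')) => [|s t Js Jt]; first by rewrite !lt_min ltr01 d0.
rewrite !lt_min => /and3P[st1 st st'].
have := ler_dist_dist s t; rewrite ler_norml => /andP[h1 h2].
have [hs|hs] := leP T `|s|; last first.
  by apply: Hd' => //; split => //; move: h1 h2 hs st1; clear; lra.
have [ht|ht] := leP T `|t|; last first.
  by apply: Hd' => //; split => //; move: h1 h2 ht st1; clear; lra.
by apply: le_lt_trans (HT s t Js Jt hs ht st) _; lra.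
Qed.

End LocalUniformContinuity.

Section MainLemma.
Variables (R : realType) (F : scalars) (X : normedModType (scalar_field R F)).
Hypothesis hX : seq_complete X.
Variable J : set R.
Hypothesis hJ : admissible_interval J.
Local Notation K := (scalar_module R F).
Local Notation scalar := (scalar_field R F).
Let upJ := admissible_up hJ.

Variables (gamma : R -> K) (c Gm a : R).
Hypothesis c0 : 0 < c.
Hypothesis gamma_cont : cont_on J gamma.
Hypothesis gamma_ge : forall t, J t -> c <= rnorm (gamma t).
Hypothesis gamma_le : forall t, J t -> rnorm (gamma t) <= Gm.
Hypothesis gamma_mean0 : forall k e, 0 < k -> 0 < e -> exists T : R, forall t, J t ->
  T <= `|t| -> rnorm (mean k gamma t) <= e.
Hypothesis a0 : 0 < a.
Hypothesis gamma_shift : BUC J (fun t => translate a gamma t / gamma t : K).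

(** Continuity alone would allow [gamma] to oscillate near an open end. This is
excluded by [gamma = gamma_a / (gamma_a / gamma)], where [gamma_a] is harmless
there and the quotient is in [BUC] and bounded away from [0]. *)
Lemma gamma_local_BUC T : BUC (window J T) gamma.
Proof.
have [t0 Jt0] := admissible_nonempty hJ.
have Gm0 := Gm_gt0 c0 gamma_ge gamma_le Jt0.
pose rho t : K := translate a gamma t / gamma t.
have rl t : window J T t -> c / Gm <= rnorm (rho t).
  move=> [Jt _]; rewrite /rho (rnormZ (translate a gamma t : K) ((gamma t)^-1 : K)).
  have Jta : J (t + a) by apply: upJ Jt _; rewrite lerDl ltW.
  rewrite ler_pM ?invr_ge0 ?(ltW c0) ?(ltW Gm0)//; first exact: gamma_ge.
  by rewrite rnormV lef_pV2 ?posrE ?gamma_le//; exact: lt_le_trans (gamma_ge Jt).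
have rB : BUC (window J T) rho by apply: BUC_sub gamma_shift => t [].
have riB := BUC_inv (divr_gt0 c0 Gm0) rl rB.
have gaB : BUC (window J T) (translate a gamma).
  by apply: translate_local_BUC => //; exists Gm.
apply: eq_BUC (BUC_scale riB gaB) => t [Jt _].
have Jta : J (t + a) by apply: upJ Jt _; rewrite lerDl ltW.
rewrite /rho /GRing.scale/= invf_div mulrAC -mulrA divff ?mulr1//.
exact: (gamma_neq0 c0 gamma_ge Jta).
Qed.

(** The functions [G n] with [(f - G n) / gamma] of modulus [2^-n] at infinity
are pairwise close there; [u] is obtained by gluing them. *)
Lemma sum_class_from_differences (f : R -> X) : bounded_measurable_on J f ->
  bounded_on J f ->
  sum_class_differences J gamma f ->
  exists u v, [/\ BUC J u, BUC J v & forall t, J t ->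
    f t = u t + (gamma t : scalar) *: v t].
Proof.
move=> mf fb df.
have [t0 Jt0] := admissible_nonempty hJ.
have Gm0 := Gm_gt0 c0 gamma_ge gamma_le Jt0.
have gb : bounded_on J gamma by exists Gm.
have fc : cont_on J f.
  apply: (cont_of_differences hX upJ mf fb) => h h0.
  have [u [v [hu hv E]]] := df h h0.
  apply: (@eq_cont_on _ _ _ _ (fun t => u t + (gamma t : scalar) *: v t)).
    by move=> t Jt; rewrite E.
  apply: cont_onD; first exact: BUC_cont.
  by apply: cont_on_scale => //; exact: BUC_cont.
have p0 (n : nat) : 0 < 2^-1 ^+ n :> R by rewrite exprn_gt0// invr_gt0.
have HG n : exists G, BUC J G /\
    modulus_at_infinity J (2^-1 ^+ n) (fun t => (gamma t : scalar)^-1 *: (f t - G t)).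
  by have [G ? ?] := approx_by_BUC hX upJ c0 gamma_cont gamma_ge gamma_le gamma_mean0 fc
    fb df (p0 n); exists G.
have [G HG'] := choice HG.
(* Increments of [G] at infinity: at most twice [2^-n] from the two moduli,
   times the constant of [small_at_infinity]. *)
pose A := (Gm + 2) * 2.
have A0 : 0 < A by rewrite /A mulr_gt0// addr_gt0.
have [|n|u uB Hu] := @glue _ _ _ hX J G A A0.
- by move=> n; have [] := HG' n.
- have [B1 M1] := HG' n; have [B2 M2] := HG' n.+1.
  have e0 : 0 < 2^-1 ^+ n + 2^-1 ^+ n.+1 :> R by rewrite addr_gt0.
  have M : modulus_at_infinity J (2^-1 ^+ n + 2^-1 ^+ n.+1)
      (fun t => (gamma t : scalar)^-1 *: (G n.+1 t - G n t)).
    have [d d0 [T HT]] := modulus_at_infinityB M1 M2.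
    exists d => //; exists T => s t Js Jt Ts Tt st.
    have E r : (gamma r : scalar)^-1 *: (G n.+1 r - G n r) =
      (gamma r : scalar)^-1 *: (f r - G n r) - (gamma r : scalar)^-1 *: (f r - G n.+1 r).
      by rewrite -scalerBr subrACA_sub subrr sub0r opprB.
    by rewrite !E; exact: HT.
  have [T HT] := small_at_infinity hX upJ c0 gamma_cont gamma_ge gamma_le gamma_mean0
    (BUC_B B2 B1) e0 M.
  exists T => t Jt Tt; apply: le_trans (HT t Jt Tt) _.
  rewrite /A -mulrA ler_wpM2l//; first by rewrite addr_ge0// ltW.
  by rewrite exprS; have := p0 n; lra.
pose v t := (gamma t : scalar)^-1 *: (f t - u t).
exists u, v; split => //; last first.
  by move=> t Jt; rewrite /v scalerA divff ?scale1r ?[u t + _]addrC ?subrK//; exact: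
    (gamma_neq0 c0 gamma_ge Jt).
have vb : bounded_on J v.
  have [B fuB] := bounded_onB fb uB.2; exists (c^-1 * B) => t Jt.
  apply: le_trans (rnorm_gammaV c0 gamma_ge _ Jt) _.
  by rewrite ler_wpM2l ?invr_ge0 ?(ltW c0)// fuB.
split => //; apply: unif_continuous_from_local => [e e0|T].
- have C0 : 0 < 1 + 2 * (c^-1 * (2 * A)).
    apply: addr_gt0 => //; apply: mulr_gt0 => //; apply: mulr_gt0;
      first by rewrite invr_gt0.
    exact: mulr_gt0.
  have [n Hn] := half_pow_small C0 e0.
  (* Far out, [v] differs from [(f - G n) / gamma] by a multiple of [2^-n]. *)
  have [_ [d d0 [T HT]]] := HG' n; have [T' HT'] := Hu n.
  exists d => //; exists (Num.max T T') => s t Js Jt; rewrite !ge_max.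
  move=> /andP[Ts T's] /andP[Tt T't] st.
  have E r : v r = (gamma r : scalar)^-1 *: (f r - G n r)
    - (gamma r : scalar)^-1 *: (u r - G n r).
    by rewrite /v -scalerBr subrACA_sub subrr subr0.
  have small r : J r -> T' <= `|r| ->
      rnorm ((gamma r : scalar)^-1 *: (u r - G n r)) <= c^-1 * (2 * A) * 2^-1 ^+ n.
    move=> Jr T'r; apply: le_trans (rnorm_gammaV c0 gamma_ge _ Jr) _.
    by rewrite -mulrA ler_wpM2l ?invr_ge0 ?(ltW c0)//; exact: HT'.
  rewrite !E subrACA_sub; apply: le_trans (rnormB _ _) _.
  have h1 := HT s t Js Jt Ts Tt st; have h2 := small s Js T's; have h3 := small t Jt T't.
  apply: le_trans (lerD h1 (le_trans (rnormB _ _) (lerD h2 h3))) _.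
  apply: le_trans (ltW Hn); rewrite le_eqVlt; apply/orP; left; apply/eqP; ring.
- have wJ : window J T `<=` J by move=> t [].
  have gB := gamma_local_BUC T.
  have giB : BUC (window J T) (fun t => (gamma t : scalar)^-1 : K).
    by apply: (BUC_inv c0 _ gB) => t [Jt _]; exact: gamma_ge.
  (* Near the left end [f] is recovered from its translate by [a]. *)
  have fB : BUC (window J T) f.
    have [u' [v' [hu' hv' E]]] := df a a0.
    have : BUC (window J T) (fun t => translate a f t - (u' t + (gamma t : scalar)
      *: v' t)).
      apply: BUC_B; first exact: translate_local_BUC.
      apply: BUC_D; first exact: BUC_sub hu'.
      by apply: (BUC_scale gB); exact: BUC_sub hv'.
    apply: eq_BUC => t [Jt _]; rewrite -E// /difference /translate.
    by rewrite opprB addrC subrK.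
  by have [] := BUC_scale giB (BUC_B fB (BUC_sub wJ uB)).
Qed.

Lemma sum_class_Lb : satisfies_Lb J (add_class J (BUC (V :=
  X) J) (mul_class J gamma (BUC J))).
Proof.
move=> f [[s [ss sf]] fb] df.
have mf : bounded_measurable_on J f.
  move=> x y Jx xy; have [B B0 fB] := bounded_onP fb.
  have [s' [ss' sM' sf']] := @truncated_approx _ _ _ J f s B (B + 1)
    ltac:(lra) ltac:(lra) ss sf fB.
  exists s'; split => //; first by exists (B + 1).
  apply: ae_sub sf' => t H txy; apply: H; apply: upJ Jx _.
  by move: txy; rewrite /= in_itv/= => /andP[].
have df' : sum_class_differences J gamma f.
  move=> h h0; have [u [w [uB [v vB E] E']]] := df h h0.
  by exists u, v; split => // t Jt; rewrite E'// E.
have [u [v [uB vB E]]] := sum_class_from_differences mf fb df'.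
exists u, (fun t => (gamma t : scalar) *: v t); split => //.
by exists v.
Qed.

End MainLemma.

(** * Primitives of functions in the sum class *)

Section Primitive.
Variables (R : realType) (F : scalars) (X : normedModType (scalar_field R F)).
Hypothesis hX : seq_complete X.
Variable J : set R.
Hypothesis upJ : forall s t, J s -> s <= t -> J t.

Lemma primitiveB (al s t : R) (f : R -> X) : bounded_measurable_on J f -> J al -> J s ->
  s <= t ->
  primitive al f t - primitive al f s = bochner_integral s t f.
Proof.
move=> mf Jal Js st; have Jt := upJ Js st.
rewrite /primitive /oriented_integral.
have [as_|sa] := leP al s.
  rewrite (le_trans as_ st) (bochner_integral_split hX as_ st (mf _ _ Jal (le_trans as_
    st))).
  by rewrite addrAC subrr add0r.
have [at_|ta] := leP al t.
  by rewrite opprK addrC (bochner_integral_split hX (ltW sa) at_ (mf _ _ Js st)).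
rewrite opprK (bochner_integral_split hX st (ltW ta) (mf _ _ Js (le_trans st (ltW ta)))).
by rewrite addrC addrK.
Qed.

Lemma primitive_BUC (al : R) (f : R -> X) : bounded_measurable_on J f -> J al ->
  bounded_on J f ->
  bounded_on J (primitive al f) -> BUC J (primitive al f).
Proof.
move=> mf Jal fb Pb; split => // e e0.
have [B B0 fB] := bounded_onP fb.
have lip s t : J s -> s <= t -> rnorm (primitive al f t - primitive al f s) <= B * (t - s).
  move=> Js st; rewrite primitiveB//.
  apply: (bochner_integral_le hX st (mf _ _ Js st)) => r sr _; apply: fB; exact: upJ sr.
exists (e / B); first exact: divr_gt0.
move=> s t Js Jt; rewrite ltr_pdivlMr// => st.
have [h|/ltW h] := leP s t.
  rewrite rdistC; apply: le_lt_trans (lip s t Js h) _.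
  by move: st; rewrite distrC ger0_norm ?subr_ge0// mulrC.
apply: le_lt_trans (lip t s Jt h) _.
by move: st; rewrite ger0_norm ?subr_ge0// mulrC.
Qed.

(** A bounded primitive of a bounded function is in [BUC], hence in the class
with second summand [0]. *)
Lemma sum_class_Pb (gamma : R -> scalar_module R F) (al : R) : J al ->
  cont_on J gamma -> bounded_on J gamma ->
  satisfies_Pb J al (add_class J (BUC (V := X) J) (mul_class J gamma (BUC J))).
Proof.
move=> Jal gc gb f [u [w [uB [v vB E] E']]] Pb.
have fE t : J t -> u t + (gamma t : scalar_field R F) *: v t = f t.
  by move=> Jt; rewrite E'// E.
have fb : bounded_on J f.
  have [B HB] := bounded_onD uB.2 (bounded_on_scale gb vB.2).
  by exists B => t Jt; rewrite -fE//; exact: HB.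
have fc : cont_on J f.
  apply: (eq_cont_on fE); apply: cont_onD; first exact: BUC_cont.
  by apply: cont_on_scale => //; exact: BUC_cont.
have mf : bounded_measurable_on J f by apply: cont_bounded_measurable_on.
exists (primitive al f), (fun=> 0); split.
- exact: primitive_BUC.
- exists (fun=> 0); last by move=> t _; rewrite scaler0.
  split; last by exists 0 => t _; rewrite rnorm0.
  by move=> e e0; exists 1 => // s t _ _ _; rewrite subrr rnorm0.
- by move=> t _; rewrite addr0.
Qed.
End Primitive.

(** * Properties of gamma in the two cases *)

Section Reduction.
Variables (R : realType).

Lemma limsup_norm_le0 F (V : normedModType (scalar_field R F)) (f : R -> V) (e : R) :
  (limsup_norm f <= 0)%E -> 0 < e -> exists T : R, forall t, T <= `|t| -> rnorm (f t) <= e.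
Proof.
rewrite /limsup_norm ge_max => /andP[hp hm] e0.
have near_le (G : set_system R) : (limf_esup (fun t : R => (rnorm (f t))%:E) G <= 0)%E ->
    exists2 U, G U & forall t, U t -> rnorm (f t) <= e.
  move=> h; have : (limf_esup (fun t : R => (rnorm (f t))%:E) G < e%:E)%E.
    by apply: le_lt_trans h _; rewrite lte_fin.
  rewrite limf_esupE => /ereal_inf_lt[_ [U GU <-] Ue]; exists U => // t Ut.
  rewrite -lee_fin; apply: le_trans (ltW Ue); apply: ereal_sup_ubound.
  by exists t.
have [U [M [_ UM]] HU] := near_le _ hp; have [U' [M' [_ UM']] HU'] := near_le _ hm.
exists (Num.max (M + 1) (- M' + 1)) => t; rewrite ge_max => /andP[h1 h2].
have [t0|t0] := leP 0 t.
  by apply/HU/UM; move: h1; rewrite ger0_norm//; lra.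
by apply/HU'/UM'; move: h2; rewrite ltr0_norm//; lra.
Qed.

Lemma C0_vanishing F (V : normedModType (scalar_field R F)) (J : set R) (f : R ->
  V) (e : R) :
  admissible_interval J -> C0 J f -> 0 < e ->
  exists T : R, forall t, J t -> T <= `|t| -> rnorm (f t) <= e.
Proof.
move=> hJ [_ fp fm] e0.
have /cvg_rnorm_nearP/(_ e e0)[M [_ HM]] := fp.
have low (al : R) : (forall t, J t -> al <= t) ->
    exists T : R, forall t, J t -> T <= `|t| -> rnorm (f t) <= e.
  move=> Jal; exists (Num.max (M + 1) (`|al| + 1)) => t Jt.
  rewrite ge_max => /andP[h1 h2]; have := Jal t Jt => h3.
  have t0 : 0 <= t.
    rewrite leNgt; apply/negP => t0; move: h2; rewrite (ltr0_norm t0).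
    have := ler_norm (- al); rewrite normrN; lra.
  rewrite -(subr0 (f t)); apply/ltW/HM; move: h1; rewrite ger0_norm//; lra.
case: hJ => [[al E]|[al E]|E].
- by apply: (low al) => t; rewrite E/= in_itv/= andbT.
- by apply: (low al) => t; rewrite E/= in_itv/= andbT => /ltW.
have /cvg_rnorm_nearP/(_ e e0)[M' [_ HM']] := fm E.
exists (Num.max (M + 1) (- M' + 1)) => t _; rewrite ge_max => /andP[h1 h2].
rewrite -(subr0 (f t)); have [t0|t0] := leP 0 t.
  by apply/ltW/HM; move: h1; rewrite ger0_norm//; lra.
by apply/ltW/HM'; move: h2; rewrite ltr0_norm//; lra.
Qed.

Lemma inf_norm_lower F (g : R -> scalar_module R F) (J : set R) (t : R) : J t ->
  inf [set rnorm (g t) | t in J] <= rnorm (g t).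
Proof.
move=> Jt; apply: ge_inf; last by exists t.
by exists 0 => _ [s _ <-]; exact: rnorm_ge0.
Qed.

Variables (F : scalars) (X : completeNormedModType (scalar_field R F)).
Local Notation K := (scalar_module R F).
Local Notation scalar := (scalar_field R F).

(** Invariance applied to [gamma x] reads [gamma_a x = gamma v], so [v =
(gamma_a / gamma) x]. *)
Lemma translation_invariant_quotient (gamma : R -> K) (x : X) (a : R) : x != 0 ->
  (forall t, (gamma t : scalar) != 0) ->
  translation_invariant (mul_class setT gamma (BUC (V := X) setT)) ->
  BUC setT (fun t => translate a gamma t / gamma t : K).
Proof.
move=> x0 gn inv.
have cx : BUC setT (fun=> x : X).
  split; last by exists (rnorm x).
  by move=> e e0; exists 1 => // s t _ _ _; rewrite subrr rnorm0.
have [v [vu [B vB]] E] := inv _ (ex_intro2 _ _ _ cx (fun t _ => erefl)) a.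
have rx : 0 < rnorm x by rewrite lt_neqAle eq_sym rnorm_eq0 x0 rnorm_ge0.
have vE t : v t = (translate a gamma t / gamma t : scalar) *: x.
  by rewrite mulrC -scalerA [_ *: x](E t I) scalerA mulVf// scale1r.
split; last first.
  exists (B / rnorm x) => t _; rewrite ler_pdivlMr//.
  by have := vB t I; rewrite vE (rnormZ (translate a gamma t / gamma t : K)).
move=> e e0; have [d d0 Hd] := vu (e * rnorm x) (mulr_gt0 e0 rx).
exists d => // s t _ _ st; rewrite -(ltr_pM2r rx).
have := Hd s t I I st.
by rewrite !vE -scalerBl (rnormZ (translate a gamma s / gamma s - translate a gamma t /
  gamma t : K)).
Qed.

(** Since [M_k (gamma x) = gamma w], the norm inequality for the vanishing
function [M_k (gamma x) + gamma (- w)] forces [M_k (gamma x)] to [0] at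
infinity. *)
Lemma mean_vanishing (gamma : R -> K) (x : X) (k e : R) : x != 0 ->
  cont_on setT gamma -> bounded_on setT gamma ->
  mul_class setT gamma (BUC (V := X) setT) `<=`
    mean_class setT (mul_class setT gamma (BUC (V := X) setT)) ->
  (forall u v : R -> X, BUC setT u -> BUC setT v ->
    (limsup_norm u <= sup_norm (fun t => u t + (gamma t : scalar) *: v t)%R)%E) ->
  0 < k -> 0 < e -> exists T : R, forall t, T <= `|t| -> rnorm (mean k gamma t) <= e.
Proof.
move=> x0 gc gb hM hL k0 e0.
have hX := @complete_seq_complete R F X.
have cx : BUC setT (fun=> x : X).
  split; last by exists (rnorm x).
  by move=> d d0; exists 1 => // s t _ _ _; rewrite subrr rnorm0.
have rx : 0 < rnorm x by rewrite lt_neqAle eq_sym rnorm_eq0 x0 rnorm_ge0.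
pose f t : X := (gamma t : scalar) *: x.
have [_ /(_ k k0) [w wB Ew]] : mean_class setT (mul_class setT gamma (BUC (V := X) setT)) f.
  by apply: hM; exists (fun=> x).
have up (s t : R) : [set: R] s -> s <= t -> [set: R] t by [].
have fc : cont_on setT f by apply: cont_on_scale => //; exact: BUC_cont.
have fb : bounded_on setT f by apply: bounded_on_scale => //; case: cx.
have mf : bounded_measurable_on setT f by exact: (cont_bounded_measurable_on up).
have mB : BUC setT (mean k f) by exact: (mean_BUC hX up).
have nB : BUC setT (fun t => - w t).
  by have := BUC_B cx (BUC_D cx wB); apply: eq_BUC => t _; rewrite opprD addrA subrr sub0r.
have := hL _ _ mB nB.
have -> : (fun t => mean k f t + (gamma t : scalar) *: - w t) = fun=> 0.
  by apply/funext => t; rewrite Ew// scalerN subrr.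
have -> : sup_norm (fun=> 0 : X) = 0%E.
  rewrite /sup_norm (_ : range _ = [set 0%E]) ?ereal_sup1//.
  by apply/seteqP; split=> [_ [t _ <-]|_ ->]; [|exists 0]; rewrite // rnorm0.
move=> hl; have [T HT] := limsup_norm_le0 hl (mulr_gt0 e0 rx).
exists T => t Tt; rewrite -(ler_pM2r rx); apply: le_trans (HT t Tt).
rewrite (mean_scale_vec hX x k0 (I : [set: R] t)) ?rnormZ//.
exact: (cont_bounded_measurable_on up).
Qed.

End Reduction.

Theorem corollary6p9 (R : realType) (F : scalars)
  (X : completeNormedModType (scalar_field R F)) (hX : exists x : X, x != 0)
  (J : set R) (hJ : admissible_interval J)
  (alpha0 : R) (halpha0 : J alpha0) (halpha00 : J 0 -> alpha0 = 0)
  (gamma : R -> scalar_module R F)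
  (hgamma :
    [/\ BC setT gamma,
        0 < inf (range (fun t => rnorm (gamma t))),
        translation_invariant (mul_class setT gamma (BUC (V := X) setT)),
        mul_class setT gamma (BUC (V := X) setT) `<=`
          mean_class setT (mul_class setT gamma (BUC (V := X) setT)) &
        forall u v : R -> X, BUC setT u -> BUC setT v ->
          (limsup_norm u <= sup_norm (fun t => u t + gamma t *: v t)%R)%E]
    \/
    [/\ F = ComplexScalars,
        BC J gamma,
        0 < inf [set rnorm (gamma t) | t in J],
        mean_class J (C0 J) gamma &
        exists2 eps0 : R, 0 < eps0 &
          forall a : R, 0 < a -> a < eps0 ->
            BUC J (fun t => translate a gamma t / gamma t : scalar_module R F)]) :
  satisfies_Pb J alpha0
    (add_class J (BUC (V := X) J) (mul_class J gamma (BUC J))) /\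
  satisfies_Lb J
    (add_class J (BUC (V := X) J) (mul_class J gamma (BUC J))).
Proof.
have hXc := @complete_seq_complete R F X.
have upJ := admissible_up hJ.
suff [gc gb [c c0 gl] [a a0 ga] g0] : [/\ cont_on J gamma, bounded_on J gamma,
    exists2 c : R, 0 < c & forall t, J t -> c <= rnorm (gamma t),
    exists2 a : R, 0 < a &
      BUC J (fun t => translate a gamma t / gamma t : scalar_module R F) &
    forall k e : R, 0 < k -> 0 < e -> exists T : R, forall t, J t -> T <= `|t| ->
      rnorm (mean k gamma t) <= e].
  split; first exact: sum_class_Pb.
  by have [Gm gu] := gb; exact: (sum_class_Lb hXc hJ c0 gc gl gu g0 a0 ga).
case: hgamma => [[[gcw gb] ginf ginv gM gL]|[_ [gcw gb] ginf [_ gC0] [eps0 eps00 ga]]].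
- have [x x0] := hX; have JT : J `<=` setT by [].
  have gc := within_cont_on gcw.
  have gl t : inf (range (fun t => rnorm (gamma t))) <= rnorm (gamma t).
    exact: (@inf_norm_lower R F gamma setT).
  have gn t : (gamma t : scalar_field R F) != 0.
    by rewrite -(@rnorm_eq0 _ _ (scalar_module R F)) gt_eqF//; exact: lt_le_trans (gl t).
  split.
  + exact: cont_on_sub gc.
  + by have [B gB] := gb; exists B => t _; exact: gB.
  + by exists (inf (range (fun t => rnorm (gamma t)))).
  + by exists 1 => //; apply: BUC_sub JT _; exact:
    (translation_invariant_quotient 1 x0 gn ginv).
  + move=> k e k0 e0; have [T HT] := mean_vanishing x0 gc gb gM gL k0 e0.
    by exists T => t _; exact: HT.
- split.
  + exact: within_cont_on.
  + by [].
  + by exists (inf [set rnorm (gamma t) | t in J]) => // t Jt; exact: inf_norm_lower.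
  + exists (eps0 / 2); first by rewrite divr_gt0.
    by apply: ga; lra.
  + by move=> k e k0 e0; exact: C0_vanishing (gC0 k k0) e0.
Qed.
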